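(* Let $z_n=((z_{n,i})_{i\in\mathcal{I}},(z_{n,j})_{j\in\mathcal{J}},(z_{n,k})_{k\in\mathcal{K}})$, $n\in\mathbb{N}$, be a free-free-Boolean independent sequence of three-faced families of random variables in $(\mathcal{A},\phi)$ such that: 1. $\phi(z_{n,l})=0$ for all $l\in\mathcal{I}\amalg\mathcal{J}\amalg\mathcal{K}$ and $n\in\mathbb{N}$; 2. $\sup_{n\in\mathbb{N}}|\phi(z_{n,l_1}\cdots z_{n,l_m})|=D_{l_1,\dots,l_m}<\infty$ for every $l_1,\dots,l_m\in\mathcal{I}\amalg\mathcal{J}\amalg\mathcal{K}$; 3. $\lim_{N\to\infty}\frac1N\sum_{n=1}^N\phi(z_{n,l}z_{n,l'})=C_{l,l'}$ for every $l,l'\in\mathcal{I}\amalg\mathcal{J}\amalg\mathcal{K}$. Let $S_N=((S_{N,i})_{i\in\mathcal{I}},(S_{N,j})_{j\in\mathcal{J}},(S_{N,k})_{k\in\mathcal{K}})$, where $S_{N,k}=\frac{1}{\sqrt N}\sum_{n=1}^N z_{n,k}$ for $k\in\mathcal{I}\amalg\mathcal{J}\amalg\mathcal{K}$. Let $\Gamma_C$ be the free-free-Boolean central limit distribution with matrix $C=(C_{k,l})_{k,l\in\mathcal{I}\amalg\mathcal{J}\amalg\mathcal{K}}$. Then $$\lim_{N\to\infty}\mu_{S_N}(P)=\Gamma_C(P)$$ for all $P\in\mathbb{C}\langle Z_k\mid k\in\mathcal{I}\amalg\mathcal{J}\amalg\mathcal{K}\rangle$.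
   Context: All vector spaces and algebras are over $\mathbb{C}$. A noncommutative probability space $(\mathcal{A},\phi)$ is a unital algebra $\mathcal{A}$ with a linear functional $\phi$ such that $\phi(1_{\mathcal{A}})=1$. A triple of faces in $(\mathcal{A},\phi)$ is an ordered triple $(B,C,D)$ of (not necessarily unital) subalgebras of $\mathcal{A}$. A three-faced family of random variables in $(\mathcal{A},\phi)$ is an ordered triple $a=((a_i)_{i\in\mathcal{I}},(a_j)_{j\in\mathcal{J}},(a_k)_{k\in\mathcal{K}})$ of families of elements of $\mathcal{A}$; its distribution is the functional $\mu_a:\mathbb{C}\langle Z_k\mid k\in\mathcal{I}\amalg\mathcal{J}\amalg\mathcal{K}\rangle\to\mathbb{C}$, $\mu_a=\phi\circ\alpha$, where $\alpha$ is the unital homomorphism with $\alpha(Z_k)=a_k$. **Reduced free products.** A vector space with a specified vector is a triple $(\mathcal{X},\mathring{\mathcal{X}},\xi)$ with $\mathring{\mathcal{X}}$ a codimension one subspace of $\mathcal{X}$ and $\xi\in\mathcal{X}\setminus\mathring{\mathcal{X}}$. Let $\mathcal{L}(\mathcal{X})$ be the algebra of linear operators on $\mathcal{X}$ and $\phi_\xi(T)=f(T\xi)$, where $f$ is the linear functional on $\mathcal{X}$ with $f(\xi)=1$, $\ker f=\mathring{\mathcal{X}}$. The reduced free product of $(\mathcal{X}_i,\mathring{\mathcal{X}}_i,\xi_i)_{i\in I}$ is $(\mathcal{X},\mathring{\mathcal{X}},\xi)$ with $\mathcal{X}=\mathbb{C}\xi\oplus\mathring{\mathcal{X}}$ and $\mathring{\mathcal{X}}=\bigoplus_{n\ge1}\bigoplus_{i_1\ne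 i_2\ne\cdots\ne i_n}\mathring{\mathcal{X}}_{i_1}\otimes\cdots\otimes\mathring{\mathcal{X}}_{i_n}$. Let $\mathcal{X}(\ell,i)$ (resp. $\mathcal{X}(r,i)$) be the sum of $\mathbb{C}\xi$ and the summands with $i_1\neq i$ (resp. $i_n\ne i$). Let $V_i:\mathcal{X}_i\otimes\mathcal{X}(\ell,i)\to\mathcal{X}$ and $W_i:\mathcal{X}(r,i)\otimes\mathcal{X}_i\to\mathcal{X}$ be the natural isomorphisms (identify $\xi_i\otimes\xi$ and $\xi\otimes \xi_i$ with $\xi$, absorb a single factor $\xi_i$ or $\xi$, and concatenate tensors otherwise). Put $\lambda_i(T)=V_i(T\otimes I)V_i^{-1}$ and $\rho_i(T)=W_i(I\otimes T)W_i^{-1}$ for $T\in\mathcal{L}(\mathcal{X}_i)$, and let $P_i$ be the projection of $\mathcal{X}$ onto $\mathbb{C}\xi\oplus\mathring{\mathcal{X}}_i$ vanishing on all other direct summands. **Free-free-Boolean independence.** A family $\{(B_i,C_i,D_i)\}_{i\in I}$ of triples of faces in $(\mathcal{A},\phi)$ is free-free-Boolean independent if there are vector spaces with specified vectors $(\mathcal{X}_i,\mathring{\mathcal{X}}_i,\xi_i)_{i\in I}$ and (not necessarily unital) homomorphisms $\ell_i:B_i\to\mathcal{L}(\mathcal{X}_i)$, $r_i:C_i\to\mathcal{L}(\mathcal{X}_i)$, $m_i:D_i\to\mathcal{L}(\mathcal{X}_i)$ such that, with $(\mathcal{X},\mathring{\mathcal{X}},\xi)$ the reduced free product, for every $n\geq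 1$ and every word $z_1\cdots z_n$, each $z_k$ being an element of a specified one of the algebras $B_{i_k},C_{i_k},D_{i_k}$, one has $\phi(z_1\cdots z_n)=\phi_\xi(Z_1\cdots Z_n)$, where $Z_k=\lambda_{i_k}(\ell_{i_k}(z_k))$, $\rho_{i_k}(r_{i_k}(z_k))$ or $P_{i_k}\lambda_{i_k}(m_{i_k}(z_k))P_{i_k}$ according as $z_k$ is taken from $B_{i_k}$, $C_{i_k}$ or $D_{i_k}$. A sequence of three-faced families $z_n=((z_{n,i})_{i\in\mathcal{I}},(z_{n,j})_{j\in\mathcal{J}},(z_{n,k})_{k\in\mathcal{K}})$ is free-free-Boolean independent if the triples $(B_n,C_n,D_n)$, $n\in\mathbb{N}$, are, where $B_n,C_n,D_n$ are the nonunital algebras generated by $(z_{n,i})_{i\in\mathcal{I}}$, $(z_{n,j})_{j\in\mathcal{J}}$, $(z_{n,k})_{k\in\mathcal{K}}$ respectively. **Partitions.** $[n]=\{1,\dots,n\}$. Let $\chi:[n]\to\{\ell,c,r\}$, $\chi^{-1}\{\ell,c\}=\{i_1<\cdots<i_p\}$, $\chi^{-1}\{r\}=\{i_{p+1}>\cdots>i_n\}$. The total order $\prec_\chi$ on $[n]$ is $i_1\prec_\chi i_2\prec_\chi\cdots\prec_\chi i_n$. A partition $\pi$ of $[n]$ is $\chi$-noncrossing if it is noncrossing with respect to $\prec_\chi$; it is $\chi$-interval if $i,j,k$ are in the same block whenever $i<j<k$ (natural order), $i$ and $k$ are in the same block and $\chi(j)=c$. $IBNC(\chi)$ is the set of partitions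 that are both, ordered by $\sigma\le\pi$ iff each block of $\sigma$ is contained in a block of $\pi$. $1_{[n]}$ is the one-block partition, and $\mu_{IBNC}$ is the Möbius function of the finite poset $IBNC(\chi)$. **Cumulants.** In $(\mathcal{A},\phi)$, for $V=\{l_1<\cdots<l_k\}\subset[n]$ let $\phi_V(z_1,\dots,z_n)=\phi(z_{l_1}\cdots z_{l_k})$ and $\phi_\sigma=\prod_{V\in\sigma}\phi_V$; then $\kappa_{\chi,1_{[n]}}(z_1,\dots,z_n)=\sum_{\sigma\in IBNC(\chi)}\mu_{IBNC}(\sigma,1_{[n]})\phi_\sigma(z_1,\dots,z_n)$. **Central limit distribution.** For $\omega:[n]\to\mathcal{I}\amalg\mathcal{J}\amalg\mathcal{K}$ let $\chi_\omega(i)=\ell,r,c$ according as $\omega(i)\in\mathcal{I},\mathcal{J},\mathcal{K}$. A three-faced family $z$ has a free-free-Boolean central limit distribution if $\kappa_{\chi_\omega,1_{[n]}}(z_{\omega(1)},\dots,z_{\omega(n)})=0$ for all $n\ne2$ and all $\omega:[n]\to\mathcal{I}\amalg\mathcal{J}\amalg\mathcal{K}$. For a complex matrix $C=(C_{k,l})$, $\Gamma_C:\mathbb{C}\langle Z_k\mid k\in\mathcal{I}\amalg\mathcal{J}\amalg\mathcal{K}\rangle\to\mathbb{C}$ denotes the unique free-free-Boolean central limit distribution with $\Gamma_C(Z_kZ_l)=C_{k,l}$ for all $k,l$ (i.e. the unique linear functional with $\Gamma_C(1)=1$, $\Gamma_C(Z_kZ_l)=C_{k,l}$, and such that the cumulants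 $\kappa_{\chi_\omega,1_{[n]}}(Z_{\omega(1)},\dots,Z_{\omega(n)})$ computed with respect to $\Gamma_C$ vanish for $n\neq2$). *)

(* Defs.v *)
From HB Require Import structures.
From mathcomp Require Import all_boot all_order all_algebra.
From mathcomp Require Import finmap complex monalg.
From mathcomp Require Import all_classical all_reals all_analysis.
(* The complex numbers are R[i] for R : realType; the algebraic constructions are
   made over an arbitrary field F. *)
Set Implicit Arguments.
Unset Strict Implicit.
Unset Printing Implicit Defensive.
Import numFieldNormedType.Exports.
Import Order.TTheory GRing.Theory Num.Theory.
Local Open Scope classical_set_scope.
Local Open Scope ring_scope.
Local Open Scope quotient_scope.
Local Open Scope complex_scope.

Section Span.
Variables (F : fieldType) (V : lmodType F).

Definition is_subspace (M : set V) : Prop :=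
  M 0 /\ forall a u v, M u -> M v -> M (a *: u + v).

Definition span (S : set V) : set V := smallest is_subspace S.

Lemma span_subspace S : is_subspace (span S).
Proof.
split=> [M [[M0 _] _] //|a u v Su Sv M MS].
have [[_ MP] _] := MS; apply: MP; [exact: (Su _ MS) | exact: (Sv _ MS)].
Qed.

Lemma sub_span S : S `<=` span S.
Proof. by move=> x Sx M [_ MS]; apply: MS. Qed.

Lemma subspaceN M u : is_subspace M -> M u -> M (- u).
Proof.
by move=> [M0 MP] Mu; rewrite -[- u]addr0 -scaleN1r; exact: MP.
Qed.

Lemma subspaceD M u v : is_subspace M -> M u -> M v -> M (u + v).
Proof. by move=> [_ MP] Mu Mv; rewrite -[u]scale1r; apply: MP. Qed.

Lemma subspaceZ M a u : is_subspace M -> M u -> M (a *: u).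
Proof. by move=> [M0 MP] Mu; rewrite -[_ *: _]addr0; apply: MP. Qed.

Lemma subspace_sum M (T : Type) (r : seq T) (G : T -> V) :
  is_subspace M -> (forall t, M (G t)) -> M (\sum_(t <- r) G t).
Proof.
move=> sM MG; elim/big_rec: _ => [|t u _ Mu]; first exact: sM.1.
exact: subspaceD.
Qed.

Definition in_span (S : set V) : {pred V} := fun u => `[< span S u >].

Fact in_span_zmod S : zmod_closed (in_span S).
Proof.
have sS := span_subspace S; split; first by apply/asboolP; exact: sS.1.
move=> u v /asboolP Su /asboolP Sv; apply/asboolP.
by apply: (subspaceD sS) => //; exact: (subspaceN sS).
Qed.

HB.instance Definition _ S :=
  GRing.isZmodClosed.Build V (in_span S) (in_span_zmod S).

(* The quotient of V by the subspace spanned by S. *)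
Definition lquot (S : set V) : Type := Quotient.quot (in_span S).

HB.instance Definition _ S := GRing.Zmodule.on (lquot S).

Section Lmod.
Variable S : set V.
Local Notation Q := (lquot S).


Definition lpi (u : V) : Q := \pi_(Quotient.quot (in_span S)) u.

Definition lrepr (q : Q) : V := repr (q : Quotient.quot (in_span S)).

Lemma lreprK : cancel lrepr lpi.
Proof. exact: reprK. Qed.

Lemma lpiP u v : lpi u = lpi v <-> span S (u - v).
Proof.
split=> [/eqP|sp]; first by rewrite -Quotient.idealrBE => /asboolP.
by apply/eqP; rewrite -Quotient.idealrBE; apply/asboolP.
Qed.

Lemma lpiD : {morph lpi : u v / u + v}.
Proof. exact: raddfD. Qed.

Definition lscale (a : F) (q : Q) : Q := lpi (a *: lrepr q).

Lemma lpiZ a u : lpi (a *: u) = lscale a (lpi u).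
Proof.
apply/lpiP; rewrite -scalerBr; apply: (subspaceZ _ (span_subspace S)).
by apply/lpiP; rewrite lreprK.
Qed.

Lemma lscaleA a b q : lscale a (lscale b q) = lscale (a * b) q.
Proof. by rewrite -[q]lreprK -!lpiZ scalerA. Qed.

Lemma lscale1 : left_id 1 lscale.
Proof. by move=> q; rewrite -[q]lreprK -!lpiZ scale1r. Qed.

Lemma lscaleDr : right_distributive lscale +%R.
Proof.
by move=> a p q; rewrite -[p]lreprK -[q]lreprK -lpiD -!lpiZ -lpiD scalerDr.
Qed.

Lemma lscaleDl q : {morph lscale^~ q : a b / a + b}.
Proof. by move=> a b; rewrite -[q]lreprK -!lpiZ -lpiD scalerDl. Qed.

HB.instance Definition _ :=
  GRing.Zmodule_isLmodule.Build F Q lscaleA lscale1 lscaleDr lscaleDl.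

Fact lpi_linear : linear lpi.
Proof. by move=> a u v; rewrite lpiD lpiZ. Qed.

End Lmod.
End Span.
HB.instance Definition _ (F : fieldType) (V : lmodType F) (S : set V) :=
  GRing.isLinear.Build F V (lquot S) *:%R (@lpi F V S) (@lpi_linear F V S).


Section MalgLift.
Variables (F : fieldType) (W : choiceType).

Lemma malgZU (c : F) (w : W) : << c *g w >> = c *: << w >> :> {malg F[W]}.
Proof. by apply/malgP => k; rewrite mcoeffZ !mcoeffU mulrnAr mulr1. Qed.


Variables (Y : lmodType F) (g : W -> Y).

Definition malg_lift (u : {malg F[W]}) : Y := \sum_(w <- msupp u) u@_w *: g w.

Lemma malg_liftEw (d : {fset W}) u : (msupp u `<=` d)%fset ->
  malg_lift u = \sum_(w <- d) u@_w *: g w.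
Proof.
move=> le; rewrite /malg_lift [LHS](big_fset_incl _ le) => //= w _ /mcoeff_outdom ->.
by rewrite scale0r.
Qed.

Lemma malg_lift_linear : linear (malg_lift).
Proof.
move=> a u v; pose d := (msupp u `|` msupp v)%fset.
rewrite !(@malg_liftEw d) ?fsubsetUl ?fsubsetUr//.
  rewrite scaler_sumr -big_split/=; apply: eq_bigr => w _.
  by rewrite mcoeffD mcoeffZ scalerDl scalerA.
by apply: (fsubset_trans (msuppD_le _ _)); rewrite fsetSU// msuppZ_le.
Qed.

Lemma malg_liftU (w : W) : malg_lift << w >> = g w.
Proof.
by rewrite (malg_liftEw msuppU_le) big_seq_fset1 mcoeffUU scale1r.
Qed.

Lemma malg_lift0 : malg_lift 0 = 0.
Proof. by rewrite /malg_lift msupp0 big_seq_fset0. Qed.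

End MalgLift.

(* A vector space with a specified vector (X, X°, xi): pv_ker is the codimension
   one subspace X° and pv_vec the vector xi. *)
Record pvect (F : fieldType) := PVect {
  pv_space :> lmodType F;
  pv_ker : set pv_space;
  pv_vec : pv_space;
  pv_subspace : is_subspace pv_ker;
  pv_codim1 : exists2 v, ~ pv_ker v & forall x, exists a, pv_ker (x - a *: v);
  pv_vecN : ~ pv_ker pv_vec }.

Arguments pv_ker {F X} : rename.
Arguments pv_vec {F} X : rename.

Section PVectTheory.
Variables (F : fieldType) (X : pvect F).
Implicit Types x y : X.
Local Notation xi := (pv_vec X).

(* pv_fun x is the unique a with x - a *: xi in X° (pv_projP, pv_fun_uniq), i.e.
   the functional f with f(xi) = 1 and ker f = X°; pv_proj is the projection onto
   X° along xi. *)
Definition pv_fun x : F := xget 0 [set a | pv_ker (x - a *: xi)].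

Definition pv_proj x : X := x - pv_fun x *: xi.

Lemma pv_projP x : pv_ker (pv_proj x).
Proof.
rewrite /pv_proj /pv_fun; case: xgetP => // noa; exfalso.
have sX := pv_subspace X; have [v _ vX] := pv_codim1 X.
have [b xib] := vX xi; have [c xc] := vX x.
have b0 : b != 0.
  by apply: contra_notN (@pv_vecN _ X) => /eqP b0; rewrite b0 scale0r subr0 in xib.
have := noa (c / b); apply; rewrite /=.
rewrite (_ : x - _ = (- (c / b)) *: (xi - b *: v) + (x - c *: v)); first exact: sX.2.
by rewrite scalerBr scalerA !mulNr divfK // !scaleNr opprK [x - c *: v]addrC -addrA [c *: v + _]addrA subrr add0r addrC.
Qed.

Lemma pv_fun_uniq x a : pv_ker (x - a *: xi) -> pv_fun x = a.
Proof.
move=> xa; have sX := pv_subspace X; apply/eqP; rewrite -subr_eq0.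
apply: contra_notT (@pv_vecN _ X) => ab; rewrite -[xi]scale1r -(mulVf ab) -scalerA.
apply: (subspaceZ _ sX); rewrite scalerBl.
rewrite (_ : _ - _ = (x - a *: xi) - pv_proj x).
  by apply: (subspaceD sX) => //; apply: (subspaceN sX); exact: pv_projP.
by rewrite /pv_proj opprB [RHS]addrC addrA subrK.
Qed.

Lemma pv_fun_linear : scalar pv_fun.
Proof.
move=> a x y; apply: pv_fun_uniq.
rewrite (_ : _ - _ = a *: pv_proj x + pv_proj y).
  by apply: (pv_subspace X).2; exact: pv_projP.
by rewrite scalerBr scalerA scalerDl opprD addrACA.
Qed.

HB.instance Definition _ := GRing.isLinear.Build F X F *%R pv_fun pv_fun_linear.

Lemma pv_proj_linear : linear pv_proj.
Proof.
by move=> a x y; rewrite /pv_proj linearP/= scalerBr scalerA scalerDl opprD addrACA.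
Qed.

HB.instance Definition _ := GRing.isLinear.Build F X X *:%R pv_proj pv_proj_linear.

End PVectTheory.

Arguments pv_fun {F} X x.

Definition vphi (F : fieldType) (X : pvect F) (T : X -> X) : F :=
  pv_fun X (T (pv_vec X)).

(* The reduced free product is the quotient of the free vector space on the
   admissible words (i_1,x_1) ... (i_n,x_n), with i_1 != i_2 != ... != i_n and
   x_k in X°_{i_k}, by the multilinearity relations in each letter. As these
   relations preserve the sequence of indices, the quotient is the direct sum over
   all alternating (i_1,...,i_n) of X°_{i_1} (x) ... (x) X°_{i_n}; the empty word
   contributes the line spanned by xi. tens w is the class of w, that is, the
   elementary tensor x_1 (x) ... (x) x_n (and 0 when w is not admissible);
   rfp_liftE and rfp_lift_linear are its universal property. *)
Section ReducedFreeProduct.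
Variables (F : fieldType) (I : choiceType) (X : I -> pvect F).

Definition letter : choiceType := {i : I & X i}.
Implicit Types (w s t : seq letter) (i : I).

Definition lett i (x : X i) : letter := Tagged X x.

Definition admissible w : bool :=
  sorted (fun a b : letter => tag a != tag b) w
  && all (fun a : letter => `[< pv_ker (tagged a) >]) w.

Definition word : choiceType := {w | admissible w}.

Definition mono w : {malg F[word]} :=
  if insub w is Some u then << u >> else 0.

Definition tensor_rel : set {malg F[word]} :=
  [set r | exists s t i (x y : X i) (a : F),
     [/\ pv_ker x, pv_ker y &
     r = mono (s ++ lett (a *: x + y) :: t)
         - (a *: mono (s ++ lett x :: t) + mono (s ++ lett y :: t))] ].

Definition rfp_space : lmodType F := lquot tensor_rel.

Definition tens w : rfp_space := lpi tensor_rel (mono w).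

Definition multilinear_words (Y : lmodType F) (g : seq letter -> Y) : Prop :=
  forall s t i (x y : X i) (a : F), pv_ker x -> pv_ker y ->
    admissible (s ++ lett x :: t) ->
    g (s ++ lett (a *: x + y) :: t) =
      a *: g (s ++ lett x :: t) + g (s ++ lett y :: t).

Definition rfp_lift (Y : lmodType F) (g : seq letter -> Y) (u : rfp_space) : Y :=
  malg_lift (fun w : word => g (val w)) (lrepr u).

Lemma tens_multilinear : multilinear_words tens.
Proof.
move=> s t i x y a kx ky _; rewrite /tens -linearP; apply/lpiP.
by apply: sub_span; exists s, t, i, x, y, a.
Qed.

Lemma mono_nadm w : ~~ admissible w -> mono w = 0.
Proof. by move=> nw; rewrite /mono insubN. Qed.

Lemma tens_nadm w : ~~ admissible w -> tens w = 0.
Proof. by move=> nw; rewrite /tens /mono insubN// linear0. Qed.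

Lemma admissible_eq s t i (x y : X i) : pv_ker x -> pv_ker y ->
  admissible (s ++ lett x :: t) = admissible (s ++ lett y :: t).
Proof.
move=> kx ky; rewrite /admissible !all_cat/=.
rewrite !asboolT//; congr (_ && _).
by case: s => [|b s]; case: t => [|c t] //=; rewrite !cat_path.
Qed.

Lemma admissible_lin s t i (x y : X i) a : pv_ker x -> pv_ker y ->
  admissible (s ++ lett (a *: x + y) :: t) = admissible (s ++ lett x :: t).
Proof.
by move=> kx ky; apply: admissible_eq => //; exact: (pv_subspace (X i)).2.
Qed.

Section Lift.
Variables (Y : lmodType F) (g : seq letter -> Y).

Local Notation gv := (fun w : word => g (val w)).

Lemma malg_lift_mono w : admissible w -> malg_lift gv (mono w) = g w.
Proof. by move=> aw; rewrite /mono insubT malg_liftU SubK. Qed.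

Hypothesis gM : multilinear_words g.

Lemma malg_lift_rel u : span tensor_rel u -> malg_lift gv u = 0.
Proof.
move=> su; suff H : [set M | is_subspace M /\ tensor_rel `<=` M] [set u | malg_lift gv u = 0] by exact: (su _ H).
split.
  split=> [|a v w /= v0 w0]; first exact: malg_lift0.
  by rewrite malg_lift_linear v0 w0 scaler0 addr0.
move=> _ [s [t [i [x [y [a [kx ky ->]]]]]]] /=.
rewrite -scaleN1r addrC !malg_lift_linear.
have al := admissible_lin s t a kx ky; have ae := admissible_eq s t kx ky.
have [ad|nad] := boolP (admissible (s ++ lett x :: t)).
  have ad1 := ad; rewrite -al in ad1; have ad2 := ad; rewrite ae in ad2.
  rewrite !malg_lift_mono //.
  by rewrite gM// scaleN1r addNr.
have nad1 := nad; rewrite -al in nad1; have nad2 := nad; rewrite ae in nad2.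
by rewrite !mono_nadm // malg_lift0 addr0 scaler0 addr0 scaler0.
Qed.

Lemma rfp_lift_pi u : rfp_lift g (lpi tensor_rel u) = malg_lift gv u.
Proof.
apply/eqP; rewrite -subr_eq0 -scaleN1r addrC; apply/eqP.
rewrite -malg_lift_linear; apply: malg_lift_rel.
by rewrite scaleN1r addrC; apply/lpiP; rewrite lreprK.
Qed.

Lemma rfp_liftE w : admissible w -> rfp_lift g (tens w) = g w.
Proof. by move=> aw; rewrite rfp_lift_pi malg_lift_mono. Qed.

Lemma rfp_lift_linear : linear (rfp_lift g).
Proof.
move=> a u v; rewrite -[u]lreprK -[v]lreprK -linearP !rfp_lift_pi.
exact: malg_lift_linear.
Qed.

End Lift.

Lemma mono_val (w : word) : mono (val w) = << w >>.
Proof. by rewrite /mono valK. Qed.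

Lemma rfp_tensE u :
  u = \sum_(w <- msupp (lrepr u)) (lrepr u)@_w *: tens (val w).
Proof.
rewrite -[LHS]lreprK {1}(monalgE (lrepr u)) linear_sum/=.
by apply: eq_bigr => w _; rewrite /tens mono_val malgZU linearZ.
Qed.

Definition rfp_ker : set rfp_space :=
  span [set u | exists2 w, admissible w && (w != [::]) & u = tens w].

Definition vac_coef : rfp_space -> F^o :=
  rfp_lift (fun w => (w == [::])%:R : F^o).

Fact vac_coef_multilinear :
  multilinear_words (fun w => (w == [::])%:R : F^o).
Proof.
move=> s t i x y a _ _ _.
have e z : (s ++ lett z :: t == [::] :> seq letter) = false by case: s.
by rewrite !e scaler0 addr0.
Qed.

Lemma vac_coef_ker u : rfp_ker u -> vac_coef u = 0.
Proof.
have L := rfp_lift_linear vac_coef_multilinear.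
move=> ku.
suff H : [set M | is_subspace M /\ [set u | exists2 w, admissible w && (w != [::]) & u = tens w] `<=` M] [set u | vac_coef u = 0] by exact: (ku _ H).
split.
  split=> [|a v w /= v0 w0].
    by rewrite /= -[0](subrr 0) -scaleN1r addrC /vac_coef L scaleN1r addNr.
  by rewrite /vac_coef L [rfp_lift _ v]v0 [rfp_lift _ w]w0 scaler0 addr0.
move=> _ [w /andP[aw nw] ->] /=.
by rewrite /vac_coef (rfp_liftE vac_coef_multilinear)// (negbTE nw).
Qed.

Lemma rfp_vacN : ~ rfp_ker (tens [::]).
Proof.
move=> /vac_coef_ker; rewrite /vac_coef (rfp_liftE vac_coef_multilinear)//=.
by move/eqP; rewrite oner_eq0.
Qed.

Lemma rfp_codim1 :
  exists2 v, ~ rfp_ker v & forall u, exists a, rfp_ker (u - a *: v).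
Proof.
have sK : is_subspace rfp_ker by exact: span_subspace.
exists (tens [::]); first exact: rfp_vacN.
move=> u; rewrite (rfp_tensE u); elim/big_rec: _ => [|w v _ [a Ka]].
  by exists 0; rewrite scale0r subr0; exact: sK.1.
set c := _@_w; have [w0|w0] := eqVneq (val w) [::].
  by exists (c + a); rewrite w0 scalerDl opprD addrACA subrr add0r.
exists a; rewrite -addrA; apply: sK.2 => //; apply: sub_span.
by exists (val w) => //; rewrite w0 (valP w).
Qed.

Definition rfp : pvect F :=
  PVect (span_subspace _ : is_subspace rfp_ker) rfp_codim1 rfp_vacN.

(* V_map x w is V_i (x (x) tens w) for w in X(l,i): with x = f(x) xi_i + x°,
   it is f(x) w + x° (x) w. V_inv i w is the elementary tensor V_i^-1 (tens w)
   (V_invK), so that lambda T is V_i (T (x) I) V_i^-1 (lambdaE, lambda_linear).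
   In V_inv, tagged_as casts the first letter to X i once its index is known to
   be i. W_map and W_inv are the analogues for W_i, acting on the last letter. *)
Definition V_map i (x : X i) w : rfp :=
  pv_fun (X i) x *: tens w + tens (lett (pv_proj x) :: w).

Definition V_inv i w : X i * seq letter :=
  if w is a :: t then
    if tag a == i then (tagged_as (lett (pv_vec (X i))) a, t)
    else (pv_vec (X i), w)
  else (pv_vec (X i), w).

Definition lambda i (T : X i -> X i) : rfp -> rfp :=
  rfp_lift (fun w => let: (x, t) := V_inv i w in V_map (T x) t).

Definition W_map i w (x : X i) : rfp :=
  pv_fun (X i) x *: tens w + tens (rcons w (lett (pv_proj x))).

Definition W_inv i w : seq letter * X i :=
  if w is a :: t then
    let b := last a t in
    if tag b == i then (belast a t, tagged_as (lett (pv_vec (X i))) b)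
    else (w, pv_vec (X i))
  else (w, pv_vec (X i)).

Definition rho i (T : X i -> X i) : rfp -> rfp :=
  rfp_lift (fun w => let: (t, x) := W_inv i w in W_map t (T x)).

(* The words kept are the empty one and the one-letter words of index i. *)
Definition P_proj i : rfp -> rfp :=
  rfp_lift (fun w => if all (fun a : letter => tag a == i) w && (size w <= 1)%N
                     then tens w else 0).

Lemma pv_fun_ker i (x : X i) : pv_ker x -> pv_fun (X i) x = 0.
Proof. by move=> kx; apply: pv_fun_uniq; rewrite scale0r subr0. Qed.

Lemma pv_fun_vec i : pv_fun (X i) (pv_vec (X i)) = 1.
Proof.
by apply: pv_fun_uniq; rewrite scale1r subrr; exact: (pv_subspace (X i)).1.
Qed.

Lemma V_inv_cons i (x : X i) t : V_inv i (lett x :: t) = (x, t).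
Proof. by rewrite /V_inv /= eqxx tagged_asE. Qed.

Lemma W_inv_rcons i t (a : letter) :
  W_inv i (rcons t a) = if tag a == i then (t, tagged_as (lett (pv_vec (X i))) a)
                       else (rcons t a, pv_vec (X i)).
Proof. by case: t => [|b t] //=; rewrite last_rcons belast_rcons. Qed.

Lemma W_inv_rcons_lett i w (x : X i) : W_inv i (rcons w (lett x)) = (w, x).
Proof. by rewrite W_inv_rcons /= eqxx tagged_asE. Qed.

Lemma tens_lin s t i (x y : X i) (a : F) : pv_ker x -> pv_ker y ->
  tens (s ++ lett (a *: x + y) :: t) =
  a *: tens (s ++ lett x :: t) + tens (s ++ lett y :: t).
Proof.
move=> kx ky; have [ad|nad] := boolP (admissible (s ++ lett x :: t)).
  exact: tens_multilinear.
rewrite !tens_nadm ?scaler0 ?addr0 ?admissible_lin//.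
by rewrite -(admissible_eq s t kx ky).
Qed.

Lemma tens_lett0 s t i : tens (s ++ lett (0 : X i) :: t) = 0.
Proof.
have k0 : pv_ker (0 : X i) := (pv_subspace (X i)).1.
by have := tens_lin s t (-1) k0 k0; rewrite scaler0 addr0 scaleN1r addNr.
Qed.

Lemma V_map_vec i w : V_map (pv_vec (X i)) w = tens w.
Proof.
rewrite /V_map /pv_proj pv_fun_vec !scale1r subrr.
by rewrite (tens_lett0 [::]) addr0.
Qed.

Lemma W_map_vec i w : W_map w (pv_vec (X i)) = tens w.
Proof.
rewrite /W_map /pv_proj pv_fun_vec !scale1r subrr -cats1.
by rewrite tens_lett0 addr0.
Qed.

Lemma V_invK i w : admissible w -> V_map (V_inv i w).1 (V_inv i w).2 = tens w.
Proof.
case: w => [|[j x] w] aw; first exact: V_map_vec.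
have [ji|ji] := eqVneq j i; last by rewrite /V_inv /= (negbTE ji) V_map_vec.
subst j; rewrite (V_inv_cons x w) /=.
have kx : pv_ker x by case/andP: aw => _ /= /andP[/asboolP].
by rewrite /V_map /pv_proj pv_fun_ker// !scale0r subr0 add0r.
Qed.

Lemma W_invK i w : admissible w -> W_map (W_inv i w).1 (W_inv i w).2 = tens w.
Proof.
case/lastP: w => [|w [j x]] aw; first exact: W_map_vec.
have [ji|ji] := eqVneq j i; last by rewrite W_inv_rcons /= (negbTE ji) W_map_vec.
subst j; rewrite (W_inv_rcons_lett w x) /=.
have kx : pv_ker x.
  by case/andP: aw => _; rewrite all_rcons => /andP[/asboolP].
by rewrite /W_map /pv_proj pv_fun_ker// !scale0r subr0 add0r.
Qed.

Lemma V_map_linear i t : linear (fun x : X i => V_map x t).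
Proof.
move=> a x y; rewrite /V_map !linearP/=.
rewrite (tens_lin [::]) //; try exact: pv_projP.
by rewrite scalerDl !scalerA [_ * a]mulrC addrACA.
Qed.

Lemma W_map_linear i t : linear (fun x : X i => W_map t x).
Proof.
move=> a x y; rewrite /W_map !linearP/= -!cats1.
rewrite tens_lin; try exact: pv_projP.
by rewrite scalerDl !scalerA [_ * a]mulrC addrACA.
Qed.

Lemma V_map_multilinear i (x : X i) : multilinear_words (V_map x).
Proof.
move=> s t j y z a ky kz _; rewrite /V_map -!cat_cons !tens_lin//.
by rewrite !scalerDr !scalerA [_ * a]mulrC addrACA.
Qed.

Lemma W_map_multilinear i (x : X i) : multilinear_words (fun w => W_map w x).
Proof.
move=> s t j y z a ky kz _; rewrite /W_map -!cats1 -!catA !cat_cons !tens_lin//.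
by rewrite !scalerDr !scalerA [_ * a]mulrC addrACA.
Qed.

Lemma lambda_multilinear i (T : {linear X i -> X i}) :
  multilinear_words (fun w => let: (x, t) := V_inv i w in V_map (T x) t).
Proof.
move=> [|b s] t j x y a kx ky ad /=.
  have [ji|ji] := eqVneq j i.
    by subst j; rewrite !tagged_asE linearP V_map_linear.
  exact: (@V_map_multilinear _ _ [::]).
case: ifP => bi; first by rewrite V_map_multilinear// ; case/andP: ad => /= /path_sorted ss /andP[_ aa]; rewrite /admissible ss.
exact: (@V_map_multilinear _ _ (b :: s)).
Qed.

Lemma lambda_linear i (T : {linear X i -> X i}) : linear (lambda T).
Proof. exact: rfp_lift_linear (lambda_multilinear T). Qed.

Definition starts_with i w := if w is a :: _ then tag a == i else false.

Definition ends_with i w := if w is a :: t then tag (last a t) == i else false.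

Lemma lambdaE i (T : {linear X i -> X i}) (x : X i) w :
  admissible w -> ~~ starts_with i w ->
  lambda T (V_map x w) = V_map (T x) w.
Proof.
move=> aw wi; rewrite /V_map -/(V_map _ _) lambda_linear.
rewrite /lambda !(rfp_liftE (lambda_multilinear T)).
- rewrite V_inv_cons (_ : V_inv i w = (pv_vec (X i), w)).
    by rewrite -V_map_linear -linearP /pv_proj addrC subrK.
  by case: w wi {aw} => //= b t /negbTE ->.
- have /andP[sw kw] := aw; rewrite /admissible /= kw andbT.
  rewrite (introT (asboolP _) (pv_projP x)) andbT.
  by case: w wi sw {aw kw} => //= b t bi ->; rewrite eq_sym bi.
- exact: aw.
Qed.


Lemma rho_multilinear i (T : {linear X i -> X i}) :
  multilinear_words (fun w => let: (t, x) := W_inv i w in W_map t (T x)).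
Proof.
move=> s t j x y a kx ky ad; case/lastP: t ad => [|t b] ad.
  rewrite !cats1 !W_inv_rcons /=; have [ji|ji] := eqVneq j i.
    by subst j; rewrite !tagged_asE linearP W_map_linear.
  by rewrite -!cats1; apply: W_map_multilinear => //; rewrite cats1 -cats1.
rewrite -!rcons_cons -!rcons_cat !W_inv_rcons; case: ifP => bi.
  apply: W_map_multilinear => //; move: ad; rewrite -rcons_cons -rcons_cat.
  rewrite /admissible all_rcons => /andP[ss /andP[_ ->]]; rewrite andbT.
  by move: ss; rewrite -cats1; case: (s ++ _) => //= c r; rewrite cat_path => /andP[].
rewrite !rcons_cat !rcons_cons; exact: W_map_multilinear.
Qed.

Lemma rho_linear i (T : {linear X i -> X i}) : linear (rho T).
Proof. exact: rfp_lift_linear (rho_multilinear T). Qed.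

Lemma rhoE i (T : {linear X i -> X i}) (x : X i) w :
  admissible w -> ~~ ends_with i w ->
  rho T (W_map w x) = W_map w (T x).
Proof.
move=> aw wi; rewrite /W_map -/(W_map _ _) rho_linear.
rewrite /rho !(rfp_liftE (rho_multilinear T)).
- rewrite W_inv_rcons /= eqxx tagged_asE (_ : W_inv i w = (w, pv_vec (X i))).
    by rewrite -W_map_linear -linearP /pv_proj addrC subrK.
  by case: w wi {aw} => //= b t /negbTE ->.
- have /andP[sw kw] := aw; rewrite /admissible all_rcons kw andbT /=.
  rewrite (introT (asboolP _) (pv_projP x)) andbT.
  by case: w wi sw {aw kw} => //= b t bi; rewrite rcons_path /= bi andbT.
- exact: aw.
Qed.

Lemma P_proj_multilinear i :
  multilinear_words (fun w => if all (fun a : letter => tag a == i) w && (size w <= 1)%N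
                     then tens w else 0).
Proof.
move=> s t j x y a kx ky ad /=; rewrite !all_cat !size_cat /=.
case: ifP => _; first exact: tens_multilinear.
by rewrite scaler0 addr0.
Qed.

Lemma P_proj_linear i : linear (@P_proj i).
Proof. exact: rfp_lift_linear (@P_proj_multilinear i). Qed.
End ReducedFreeProduct.

(* In (B_i, C_i, D_i): Lface for B, Rface for C and Cface for D; as values of chi
   they are l, r and c. *)
Inductive face := Lface | Rface | Cface.

Definition is_right (f : face) : bool := if f is Rface then true else false.
Definition is_center (f : face) : bool := if f is Cface then true else false.

Section Independence.
Variables (F : fieldType) (A : algType F) (phi : A -> F).

Definition is_subalg (B : set A) : Prop :=
  is_subspace B /\ forall x y, B x -> B y -> B (x * y).

Definition gen_subalg (S : set A) : set A := smallest is_subalg S.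

Lemma gen_subalgP S : is_subalg (gen_subalg S).
Proof.
split; first split.
- by move=> M [[[M0 _] _] _].
- move=> a u v Su Sv M MS; have [[[_ MP] _] _] := MS.
  by apply: MP; [exact: (Su _ MS)|exact: (Sv _ MS)].
- move=> x y Sx Sy M MS; have [[_ MP] _] := MS.
  by apply: MP; [exact: (Sx _ MS)|exact: (Sy _ MS)].
Qed.

(* h is only constrained on B: it stands for a homomorphism B -> L(X). *)
Definition is_alg_hom (B : set A) (X : lmodType F)
    (h : A -> {linear X -> X}) : Prop :=
  (forall a x y, B x -> B y ->
     forall v, h (a *: x + y) v = a *: h x v + h y v) /\
  (forall x y, B x -> B y -> forall v, h (x * y) v = h x (h y v)).

Definition face_op (I : choiceType) (X : I -> pvect F)
    (h : forall i, face -> A -> {linear X i -> X i})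
    (i : I) (f : face) (z : A) : rfp X -> rfp X :=
  match f with
  | Lface => lambda (h i Lface z)
  | Rface => rho (h i Rface z)
  | Cface => fun v => P_proj i (lambda (h i Cface z) (P_proj i v))
  end.

(* B i is a triple of faces; the words z_1 ... z_n have length n.+1 >= 1 and their
   k-th letter is taken from the face f k of index i k. *)
Definition ffb_independent (I : choiceType) (B : I -> face -> set A) : Prop :=
  exists (X : I -> pvect F) (h : forall i, face -> A -> {linear X i -> X i}),
    (forall i f, is_alg_hom (B i f) (h i f)) /\
    forall n (i : 'I_n.+1 -> I) (f : 'I_n.+1 -> face) (z : 'I_n.+1 -> A),
      (forall k, B (i k) (f k) (z k)) ->
      phi (\prod_(k < n.+1) z k) =
      vphi (\big[comp/id]_(k < n.+1) face_op h (i k) (f k) (z k)).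

End Independence.

(* A three-faced family is a function on the disjoint union I + J + K. *)
Section ThreeFaced.
Variables (I J K : choiceType).
Local Notation L := (I + J + K)%type.

Definition face_of (k : L) : face :=
  match k with inl (inl _) => Lface | inl (inr _) => Rface | inr _ => Cface end.

Definition ffb_independent_seq (F : fieldType) (A : algType F) (phi : A -> F)
    (z : nat -> L -> A) : Prop :=
  ffb_independent phi
    (fun n f => gen_subalg [set z n k | k in [set k | face_of k = f]]).
End ThreeFaced.

(* m bounds the depth of the recursion; moebiusE is the defining equation. *)
Fixpoint moebius_rec d (T : finPOrderType d) (m : nat) (x y : T) : int :=
  if x == y then 1 else
  if m is m'.+1 then
    if (x < y)%O then - \sum_(u : T | (x <= u < y)%O) moebius_rec m' x u else 0
  else 0.

Definition moebius d (T : finPOrderType d) (x y : T) : int :=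
  moebius_rec #|T| x y.

Lemma moebius_recE d (T : finPOrderType d) m (x y : T) :
  (#|[set u | (u < y)%O]%SET| <= m)%N ->
  moebius_rec m x y = moebius_rec #|[set u | (u < y)%O]%SET| x y.
Proof.
have [k] := ubnP m; elim: k m y => // k IHk m y.
rewrite ltnS => mk cm.
have H u : (u < y)%O -> (#|[set v | (v < u)%O]%SET| < #|[set v | (v < y)%O]%SET|)%N.
  move=> uy; apply: proper_card; apply/properP; split.
    by apply/fintype.subsetP => v; rewrite !inE => /lt_trans; apply.
  by exists u; rewrite !inE ?ltxx.
case: m mk cm => [|m] mk cm; first by case: #|_| cm.
move cE : #|_| cm => c cm; case: c cE cm => [|c] cE cm /=.
  case: ifP => // xy; case: ifP => // lxy.
  by have := H _ lxy; rewrite cE.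
case: ifP => // _; case: ifP => // _; congr (- _).
apply: eq_bigr => u /andP[_ /H]; rewrite cE ltnS => uc.
rewrite (IHk m) //; last exact: leq_trans uc _.
by rewrite (IHk c) // ; exact: leq_ltn_trans mk.
Qed.

Lemma moebiusE d (T : finPOrderType d) (x y : T) :
  moebius x y =
  if x == y then 1 else
  if (x < y)%O then - \sum_(u : T | (x <= u < y)%O) moebius x u else 0.
Proof.
rewrite /moebius.
have [k] : {k | #|T| = k.+1} by exists #|T|.-1; rewrite prednK//; apply/card_gt0P; exists x.
move=> kE; rewrite {1}kE /=; case: ifP => // _; case: ifP => // _; congr (- _).
apply: eq_bigr => u /andP[_ uy].
have lk : (#|[set v | (v < u)%O]%SET| <= k)%N.
  rewrite -ltnS -kE; apply: (@leq_trans #|[set: T]%SET|); last by rewrite cardsT.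
  apply: proper_card; apply/properP; split; first by apply/fintype.subsetP.
  by exists u; rewrite !inE ?ltxx.
by rewrite moebius_recE// [RHS]moebius_recE// kE; exact: leqW.
Qed.

Section IBNC.
Variables (n : nat) (chi : 'I_n -> face).
Implicit Types p : {set {set 'I_n}}.

(* The elements of 'I_n listed in increasing order for the total order chi_lt. *)
Definition chi_seq : seq 'I_n :=
  [seq i <- enum 'I_n | ~~ is_right (chi i)]
  ++ rev [seq i <- enum 'I_n | is_right (chi i)].

Definition chi_lt (i j : 'I_n) : bool := (index i chi_seq < index j chi_seq)%N.

Definition chi_noncrossing p : bool :=
  [forall V in p, forall W in p, (V != W) ==>
    [forall a in V, forall b in W, forall c in V, forall d in W,
      ~~ [&& chi_lt a b, chi_lt b c & chi_lt c d]]].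

Definition chi_interval p : bool :=
  [forall V in p, forall i in V, forall k in V, forall j : 'I_n,
    [&& (i < j)%N, (j < k)%N & is_center (chi j)] ==> (j \in V)].

Definition is_ibnc p : bool :=
  [&& finset.partition p [set: 'I_n]%SET, chi_noncrossing p & chi_interval p].

Record IBNC : predArgType := MkIBNC { ibnc_val :> {set {set 'I_n}}; _ : is_ibnc ibnc_val }.

HB.instance Definition _ := [isSub for ibnc_val].
HB.instance Definition _ := [Finite of IBNC by <:].

Definition ibnc_le (s p : IBNC) : bool :=
  [forall V in ibnc_val s, exists W in ibnc_val p, V \subset W].

Lemma ibnc_leP (s p : IBNC) :
  reflect (forall V, V \in ibnc_val s -> exists2 W, W \in ibnc_val p & V \subset W)
          (ibnc_le s p).
Proof. by apply: (iffP forall_inP) => H V /H /exists_inP. Qed.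

Fact ibnc_le_refl : reflexive ibnc_le.
Proof. by move=> s; apply/ibnc_leP => V Vs; exists V. Qed.

Fact ibnc_le_trans : transitive ibnc_le.
Proof.
move=> p s q /ibnc_leP sp /ibnc_leP pq; apply/ibnc_leP => V /sp[W /pq[U Uq WU] VW].
by exists U => //; exact: fintype.subset_trans WU.
Qed.

Lemma ibnc_partition (s : IBNC) : finset.partition (ibnc_val s) [set: 'I_n]%SET.
Proof. by case: s => /= s /and3P[]. Qed.

Fact ibnc_le_anti : antisymmetric ibnc_le.
Proof.
suff H (s p : IBNC) : ibnc_le s p -> ibnc_le p s -> ibnc_val s \subset ibnc_val p.
  by move=> s p /andP[sp ps]; apply/val_inj/eqP; rewrite finset.eqEsubset !H.
move=> /ibnc_leP sp /ibnc_leP ps; apply/fintype.subsetP => V Vs.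
have [W Wp VW] := sp _ Vs; have [U Us WU] := ps _ Wp.
have [_ /finset.trivIsetP ts s0] := and3P (ibnc_partition s).
have VU : V = U.
  apply/eqP; apply: contraNT s0 => /(ts _ _ Vs Us).
  rewrite -setI_eq0 (finset.setIidPl (fintype.subset_trans VW WU)) => /eqP V0.
  by rewrite -V0.
suff -> : V = W by [].
by apply/eqP; rewrite finset.eqEsubset VW VU.
Qed.

Fact ibnc_display : Order.disp_t. Proof. exact: Order.Disp tt tt. Qed.

HB.instance Definition _ := Order.Le_isPOrder.Build ibnc_display IBNC
  ibnc_le_refl ibnc_le_anti ibnc_le_trans.

End IBNC.

Fact is_ibnc1 n (chi : 'I_n.+1 -> face) : is_ibnc chi [set [set: 'I_n.+1]]%SET.
Proof.
apply/and3P; split.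
- apply/and3P; split; first by rewrite /finset.cover big_set1.
    by apply/finset.trivIsetP => V W /set1P -> /set1P ->; rewrite eqxx.
  by rewrite inE eq_sym; apply/finset.set0Pn; exists ord0.
- apply/forall_inP => V /set1P ->; apply/forall_inP => W /set1P ->.
  by rewrite eqxx.
- apply/forall_inP => V /set1P ->; apply/forall_inP => i _.
  by apply/forall_inP => k _; apply/forallP => j; rewrite inE implybT.
Qed.

Definition ibnc1 n (chi : 'I_n.+1 -> face) : IBNC chi := MkIBNC (is_ibnc1 chi).

Arguments face_of {I J K} k.

Section Cumulants.
Variables (F : fieldType) (A : nzRingType) (phi : A -> F).

(* enum V lists V in increasing order. *)
Definition phi_part n (p : {set {set 'I_n}}) (z : 'I_n -> A) : F :=
  \prod_(V in p) phi (\prod_(l <- enum V) z l).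

Definition kappa n (chi : 'I_n.+1 -> face) (z : 'I_n.+1 -> A) : F :=
  \sum_(s : IBNC chi) (moebius s (ibnc1 chi))%:~R * phi_part s z.

(* Only n.+1 >= 1 is considered: [0] has no one-block partition. *)
Definition clt_law (I J K : choiceType) (z : I + J + K -> A) : Prop :=
  forall n (w : 'I_n.+1 -> I + J + K), n.+1 <> 2 ->
    kappa (fun m => face_of (w m)) (fun m => z (w m)) = 0.

End Cumulants.


Section NCPolynomials.
Variables (F : fieldType) (L : choiceType).

(* F<Z_k | k in L>, as the monoid algebra of the free monoid on L. *)
Definition ncpoly : lalgType F := {malg F[{fmonom L}]}.

Definition ncvar (k : L) : ncpoly := << fmu k >>.

Section Eval.
Variables (A : algType F) (a : L -> A).

Definition nceval_monom (m : {fmonom L}) : A := \prod_(k <- (m : seq L)) a k.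

Fact nceval_monom_morphism :
  {morph nceval_monom : m1 m2 / mmul m1 m2 >-> m1 * m2} /\ nceval_monom mone = 1.
Proof.
by split=> [m1 m2|]; rewrite /nceval_monom ?fmM ?fm1 ?big_cat ?big_nil.
Qed.

HB.instance Definition _ :=
  isMultiplicative.Build {fmonom L} A nceval_monom nceval_monom_morphism.

Definition nceval : ncpoly -> A := mmap (in_alg A) nceval_monom.

Lemma nceval_var k : nceval (ncvar k) = a k.
Proof. by rewrite /nceval mmapU /nceval_monom fmU big_seq1 /= scale1r mul1r. Qed.

Fact nceval_linear : linear nceval.
Proof.
by move=> c p q; rewrite /nceval mmapD mmapZ /= mulr_algl.
Qed.

HB.instance Definition _ := GRing.isLinear.Build F ncpoly A *:%R nceval nceval_linear.

Fact nceval_multiplicative : multiplicative nceval.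
Proof.
by apply: commr_mmap_is_multiplicative => g m m'; rewrite /GRing.comm /= mulr_algl mulr_algr.
Qed.

HB.instance Definition _ := GRing.isMultiplicative.Build ncpoly A nceval nceval_multiplicative.

Definition distr (phi : A -> F) : ncpoly -> F := phi \o nceval.

End Eval.
End NCPolynomials.

Section CentralLimitLaw.
Variables (F : fieldType) (I J K : choiceType).
Local Notation L := (I + J + K)%type.
Variable C : L -> L -> F.

Definition is_Gamma (G : {scalar (ncpoly F L)}) : Prop :=
  [/\ G 1 = 1, forall k l, G (ncvar F k * ncvar F l) = C k l &
      clt_law G (@ncvar F L)].

Lemma prod_ncvar (s : seq L) : \prod_(k <- s) ncvar F k = << FMonom s >>.
Proof.
elim: s => [|k s IHs]; first by rewrite big_nil -fmoneE.
rewrite big_cons IHs malgM_def fgmulUU mul1r; congr (<< _ >>).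
by apply/eqP; rewrite fmP fmM fmU.
Qed.

Lemma prod_block n (w : 'I_n -> L) (V : {set 'I_n}) :
  \prod_(l <- enum V) ncvar F (w l) = << FMonom [seq w l | l <- enum V] >>.
Proof. by rewrite -prod_ncvar big_map. Qed.

Lemma ibnc_block_lt n (chi : 'I_n.+1 -> face) (s : IBNC chi) (V : {set 'I_n.+1}) :
  s != ibnc1 chi -> V \in ibnc_val s -> (#|V| < n.+1)%N.
Proof.
move=> s1 Vs; rewrite ltnNge; apply: contra s1 => cV.
have VT : V = [set: 'I_n.+1]%SET.
  by apply/eqP; rewrite eqEcard finset.subsetT cardsT card_ord.
have [_ /finset.trivIsetP ts s0] := and3P (ibnc_partition s).
apply/eqP/val_inj/setP => W /=; rewrite finset.in_set1 -VT.
apply/idP/eqP => [Ws|->//]; apply/eqP; apply: contraNT s0 => /(ts _ _ Ws Vs).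
by rewrite -setI_eq0 VT finset.setIT => /eqP W0; rewrite -W0.
Qed.

(* The value of Gamma on monomials: solves the equation kappa = 0 for the moment
   of highest order; m is fuel for the recursion on the length. *)
Fixpoint gamma_word (m : nat) (w : seq L) : F :=
  if m is m'.+1 then
    if w is k :: t then
      if t is [:: l] then C k l else
      let om (i : 'I_(size t).+1) := nth k w i in
      let chi i := face_of (om i) in
      - \sum_(s : IBNC chi | s != ibnc1 chi)
           (moebius s (ibnc1 chi))%:~R *
           \prod_(V in ibnc_val s) gamma_word m' [seq om l | l <- enum V]
    else 1
  else 1.

Lemma gamma_word_fuel m w : (size w <= m)%N ->
  gamma_word m w = gamma_word (size w) w.
Proof.
elim: m {-2}m (leqnn m) w => [|m IHm] [|m'] //; try by move=> _ [].
rewrite ltnS => mm [|k t] //=; rewrite ltnS => tm.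
have key (n : nat) (om : 'I_n -> L) (V : {set 'I_n}) q : (q <= m)%N -> (#|V| <= q)%N ->
    gamma_word q [seq om i | i <- enum V] =
    gamma_word #|V| [seq om i | i <- enum V].
  by move=> qm Vq; rewrite IHm ?size_map -?cardE.
case: t tm => [|l [|l' t]] // tm; congr (- _); apply: eq_bigr => s s1; congr (_ * _);
  apply: eq_bigr => V Vs; have := ibnc_block_lt s1 Vs; rewrite ltnS => cV;
  by apply: etrans (key _ _ _ _ mm (leq_trans cV tm)) (esym (key _ _ _ _ (leq_trans tm mm) cV)).
Qed.

Lemma gamma_wordE n (w : 'I_n.+1 -> L) (g := fun s => gamma_word (size s) s) :
  n.+1 <> 2 ->
  let chi i := face_of (w i) in
  g [seq w i | i <- enum 'I_n.+1] =
  - \sum_(s : IBNC chi | s != ibnc1 chi) (moebius s (ibnc1 chi))%:~R *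
           \prod_(V in ibnc_val s) g [seq w l | l <- enum V].
Proof.
move=> n2; case E: [seq w i | i <- enum 'I_n.+1] => [|k t].
  by move/(congr1 size): E; rewrite size_map size_enum_ord.
have sz : size t = n by move/(congr1 size): E; rewrite size_map size_enum_ord => -[].
have wE : w = fun i : 'I_n.+1 => nth k (k :: t) i.
  apply/funext => i; rewrite -E (nth_map i) ?size_enum_ord//.
  by rewrite nth_ord_enum.
rewrite {}wE; subst n; clear E w => /=.
rewrite {1}/g /=; case: t n2 => [|l [|l' t]] // n2.
- congr (- _); apply: eq_bigr => s s1; congr (_ * _).
  apply: eq_bigr => V Vs; apply: gamma_word_fuel; rewrite size_map -cardE.
  by have := ibnc_block_lt s1 Vs.
- congr (- _); apply: eq_bigr => s s1; congr (_ * _).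
  apply: eq_bigr => V Vs; apply: gamma_word_fuel; rewrite size_map -cardE.
  by have := ibnc_block_lt s1 Vs.
Qed.

Definition gamma_fun : ncpoly F L -> F :=
  malg_lift (fun m : {fmonom L} => gamma_word (size m) m : F^o).

Lemma gamma_fun_linear : scalar gamma_fun.
Proof. exact: (@malg_lift_linear F {fmonom L} F^o). Qed.

HB.instance Definition _ :=
  GRing.isLinear.Build F (ncpoly F L) F *%R gamma_fun gamma_fun_linear.

Lemma kappaE n (w : 'I_n.+1 -> L) (chi := fun i => face_of (w i)) (G : ncpoly F L -> F) :
  kappa G chi (fun i => ncvar F (w i)) =
  G << FMonom [seq w i | i <- enum 'I_n.+1] >> +
  \sum_(s : IBNC chi | s != ibnc1 chi) (moebius s (ibnc1 chi))%:~R *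
           \prod_(V in ibnc_val s) G << FMonom [seq w l | l <- enum V] >>.
Proof.
rewrite /kappa (bigD1 (ibnc1 chi))//= moebiusE eqxx mul1r; congr (_ + _).
  rewrite /phi_part big_set1 prod_block; congr (G << FMonom [seq w l | l <- _] >>).
  by apply: eq_enum => i; rewrite !inE.
by apply: eq_bigr => s _; congr (_ * _); apply: eq_bigr => V _; rewrite prod_block.
Qed.

Lemma Gamma_exists : exists G : {scalar (ncpoly F L)}, is_Gamma G.
Proof.
pose G : {scalar (ncpoly F L)} := gamma_fun; exists G.
have gE s : G << FMonom s >> = gamma_word (size s) s by exact: (malg_liftU (Y := F^o)).
split => [|k l|n w n2].
- by have := prod_ncvar [::]; rewrite big_nil => ->; exact: gE.
- have := prod_ncvar [:: k; l]; rewrite !big_cons big_nil mulr1 => ->.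
  exact: gE.
- rewrite kappaE gE (gamma_wordE _ n2) addrC; apply/eqP; rewrite subr_eq0; apply/eqP.
  apply: eq_bigr => s _; congr (_ * _); apply: eq_bigr => V _; exact: gE.
Qed.

Lemma Gamma_unique (G G' : {scalar (ncpoly F L)}) :
  is_Gamma G -> is_Gamma G' -> G =1 G'.
Proof.
move=> [G1 GC Gk] [G'1 G'C G'k].
have mono_step s : (forall r, (size r < size s)%N ->
      G << FMonom r >> = G' << FMonom r >>) -> size s <> 2 -> size s <> 0 ->
    G << FMonom s >> = G' << FMonom s >>.
  case: s => // k t IH t2 _; set n := size t.
  pose w (i : 'I_n.+1) : L := nth k (k :: t) i.
  have sE : k :: t = [seq w i | i <- enum 'I_n.+1].
    apply: (@eq_from_nth _ k) => [|i ik]; first by rewrite size_map size_enum_ord.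
    by rewrite (nth_map ord0) ?size_enum_ord// /w nth_enum_ord.
  have := Gk n w t2; rewrite -(G'k n w t2) !kappaE -sE.
  rewrite (eq_bigr (fun s : IBNC (fun i => face_of (w i)) =>
    (moebius s (ibnc1 _))%:~R * \prod_(V in ibnc_val s)
       G' << FMonom [seq w l | l <- enum V] >>)); first exact: addIr.
  move=> s s1; congr (_ * _); apply: eq_bigr => V Vs; apply: IH.
  by rewrite size_map -cardE /=; exact: ibnc_block_lt s1 Vs.
suff H s : G << FMonom s >> = G' << FMonom s >>.
  move=> P; rewrite (monalgE P) !linear_sum; apply: eq_bigr => m _.
  rewrite malgZU !linearZ /=; congr (_ * _); rewrite -[m]fmK; exact: H.
have [n] := ubnP (size s); elim: n s => // n IHn s; rewrite ltnS.
case: s => [|k [|l [|l' t]]] // sn.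
- by rewrite -(prod_ncvar [::]) big_nil G1 G'1.
- by apply: (mono_step [:: k]) => // r rk; apply: IHn; exact: leq_trans rk sn.
- by rewrite -(prod_ncvar [:: k; l]) !big_cons big_nil mulr1 GC G'C.
- by apply: (mono_step [:: k, l, l' & t]) => // r rk; apply: IHn; exact: leq_trans rk sn.
Qed.

Definition Gamma : {scalar (ncpoly F L)} := projT1 (cid Gamma_exists).

Lemma GammaP : is_Gamma Gamma.
Proof. exact: (projT2 (cid Gamma_exists)). Qed.
End CentralLimitLaw.

(* The cast to numFieldType selects the topology given by the norm. *)
Definition cvg_C (R : realType) (u : nat -> R[i]) (l : R[i]) : Prop :=
  (u : nat -> (R[i] : numFieldType)) @ \oo --> (l : (R[i] : numFieldType)).

Lemma cvg_CP (R : realType) (u : nat -> R[i]) (l : R[i]) :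
  cvg_C u l <->
  forall e : R[i], 0 < e -> exists N : nat, forall n, (N <= n)%N -> `|l - u n| < e.
Proof.
split=> [/cvgrPdist_lt ul e e0|ul].
  by have [N _ NP] := ul e e0; exists N => n Nn; exact: NP.
apply/cvgrPdist_lt => e e0; have [N NP] := ul e e0.
by exists N => // n /= Nn; exact: NP.
Qed.

Definition cabs (R : realType) (x : R[i]) : R := complex.Re `|x|.

(* The sequence is indexed from 0: z n is the (n+1)-st family. *)
Definition normalized_sum (R : realType) (A : algType R[i]) (L : Type)
    (z : nat -> L -> A) (N : nat) (k : L) : A :=
  (sqrtC N%:R)^-1 *: \sum_(n < N) z n k.

(* Main.v *)
Require Import Defs.
From HB Require Import structures.
From mathcomp Require Import all_boot all_order all_algebra.
From mathcomp Require Import finmap complex monalg.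
From mathcomp Require Import all_classical all_reals all_analysis.
From mathcomp Require Import zify.
Set Implicit Arguments.
Unset Strict Implicit.
Unset Printing Implicit Defensive.
Import numFieldNormedType.Exports.
Import Order.TTheory GRing.Theory Num.Theory.
Local Open Scope classical_set_scope.
Local Open Scope ring_scope.
Local Open Scope complex_scope.

(** A moment of the normalized sums is N^(-n/2) times the sum, over all index maps
    f : [n] -> [N], of the mixed moments phi (z_{f 1, w 1} ... z_{f n, w n}).
    Independence realizes each of them as a vacuum expectation in one reduced free
    product (independent_model), and its size is governed by the fibres of f.

    If f takes some value only once, the mixed moment is zero: the centred operator with
    that index creates a tensor factor which no other operator can remove
    (mixed_mom_singleton).  If all fibres have two elements, each operator either creates
    a factor or meets the factor created by its partner.  Factors are created and
    annihilated at the left end by left operators, at the right end by right operators,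
    and by central operators only when nothing else is present; so up to tensors that can
    no longer return to the vacuum, the state is a scalar times the double-ended queue of
    the factors awaiting their partner (pair_state_dead).  The queue is emptied without
    obstruction exactly when the pairing by fibres is an interval-bi-noncrossing
    partition, and then the mixed moment is the product of the covariances of the pairs
    (mixed_mom_pairs, pairing_ibnc_ok).  For the remaining f, all fibres have at least two
    elements and one has more, so f has fewer than n/2 values.  There are O(N^((n-1)/2)) such
    maps, and mixed moments are bounded uniformly in f (mixed_mom_bound), so they
    contribute O(N^(-1/2)) (error_le).

    Hence the moment is asymptotically the sum over pair partitions in IBNC of products of
    averaged covariances, and this is a polynomial in the averages, which converge to C.
    The value of Gamma on the same word is that polynomial at C (Gamma_monom): a
    functional defined by summing products of prescribed cumulants over IBNC has these
    cumulants, by Moebius inversion (moebius_cmoment).  The inversion rests on the fact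
    that the elements of IBNC below a given one are obtained by choosing such a partition
    inside each of its blocks (ibnc_glue). *)

(** * Moebius inversion from above *)

Section MoebiusDual.
Variables (d : Order.disp_t) (T : finPOrderType d).
Implicit Types x y u : T.

Lemma moebius_nle x y : ~~ (x <= y)%O -> moebius x y = 0.
Proof.
move=> xy; rewrite moebiusE; case: eqVneq xy => [->|_]; first by rewrite lexx.
by rewrite le_eqVlt negb_or => /andP[_ /negbTE ->].
Qed.

Lemma moebius_suml x y :
  \sum_(u | (u <= y)%O) moebius x u = (x == y)%:R.
Proof.
rewrite (bigD1 y)//= moebiusE.
have -> : \sum_(u : T | (u <= y)%O && (u != y)) moebius x u =
          \sum_(u : T | (x <= u < y)%O) moebius x u.
  rewrite (bigID (fun u => (x <= u)%O))/= [X in _ + X]big1 ?addr0.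
    by apply: eq_bigl => u; rewrite [(u < y)%O]lt_neqAle andbC [(u != y) && _]andbC.
  by move=> u /andP[_ /moebius_nle].
case: eqVneq => [->|xy].
  rewrite big1 ?addr0// => u /andP[yu uy].
  by have := le_lt_trans yu uy; rewrite ltxx.
case: ifP => xly; first by rewrite addNr.
rewrite add0r big1// => u /andP[xu uy].
by rewrite (le_lt_trans xu uy) in xly.
Qed.

(** The Moebius function is defined as a left inverse of the zeta matrix, through sums
    over the lower end of an interval; a left inverse of a square matrix is also a right
    inverse, and this gives the sums over the upper end. *)
Lemma moebius_sumr x y :
  \sum_(u | (x <= u)%O) moebius u y = (x == y)%:R.
Proof.
pose M : 'M[int]_#|T| := \matrix_(i, j) moebius (enum_val i) (enum_val j).
pose Z : 'M[int]_#|T| := \matrix_(i, j) ((enum_val i <= enum_val j)%O)%:R.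
have MZ : M *m Z = 1%:M.
  apply/matrixP => i j; rewrite !mxE -(inj_eq enum_val_inj) -moebius_suml.
  rewrite [RHS]big_mkcond [RHS](big_enum_val (A := T))/=; apply: eq_bigr => k _.
  by rewrite !mxE; case: ifP => _; rewrite ?mulr1 ?mulr0.
have /matrixP/(_ (enum_rank x) (enum_rank y)) := mulmx1C MZ.
rewrite !mxE (inj_eq enum_rank_inj) => <-.
rewrite [LHS]big_mkcond [LHS](big_enum_val (A := T))/=; apply: eq_bigr => k _.
by rewrite !mxE !enum_rankK; case: ifP => _; rewrite ?mul1r ?mul0r.
Qed.

End MoebiusDual.

(** * The order on positions and partitions of subsets *)

Section ChiOrder.
Import boot.fintype boot.finset.
Local Open Scope set_scope.
Local Open Scope nat_scope.
Variables (n : nat) (chi : 'I_n -> face).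
Implicit Types i j k : 'I_n.

(** The order of chi_seq, compared without computing indices in that sequence. *)
Definition chi_prec i j : bool :=
  if is_right (chi i) then is_right (chi j) && (j < i)
  else is_right (chi j) || (i < j).

Lemma chi_prec_trans : transitive chi_prec.
Proof.
move=> j i k; rewrite /chi_prec.
case: (is_right (chi i)); case: (is_right (chi j)); case: (is_right (chi k)) => //=.
- by move=> ji kj; exact: ltn_trans kj ji.
- exact: ltn_trans.
Qed.

Lemma chi_prec_irr : irreflexive chi_prec.
Proof. by move=> i; rewrite /chi_prec ltnn; case: is_right. Qed.

Lemma chi_prec_total i j : i != j -> chi_prec i j || chi_prec j i.
Proof.
rewrite -(inj_eq val_inj)/= neq_ltn /chi_prec.
by case: (is_right (chi i)); case: (is_right (chi j)) => //=; rewrite orbC.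
Qed.

Lemma chi_prec_asym i j : chi_prec i j -> ~~ chi_prec j i.
Proof. by move=> ij; apply/negP => /(chi_prec_trans ij); rewrite chi_prec_irr. Qed.

Lemma mem_chi_seq i : i \in chi_seq chi.
Proof.
rewrite mem_cat mem_rev.
by apply/orP; case: (boolP (is_right (chi i))) => h; [right|left]; rewrite mem_filter h mem_enum.
Qed.

Lemma sorted_enum_ltn (V : {set 'I_n}) : sorted (fun i j => i < j) (enum V).
Proof.
have E : enum V = [seq i <- enum 'I_n | i \in V] by rewrite enumT.
rewrite E; apply: sorted_filter; first by move=> ? ? ?; exact: ltn_trans.
by have := iota_ltn_sorted 0 n; rewrite -val_enum_ord sorted_map.
Qed.

Lemma chi_seq_sorted : sorted chi_prec (chi_seq chi).
Proof.
have es : sorted (fun i j : 'I_n => i < j) (enum 'I_n).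
  by have := iota_ltn_sorted 0 n; rewrite -val_enum_ord sorted_map.
have tr : transitive (fun i j : 'I_n => i < j) by move=> ? ? ?; exact: ltn_trans.
rewrite /chi_seq sorted_pairwise; last exact: chi_prec_trans.
rewrite pairwise_cat -!sorted_pairwise; try exact: chi_prec_trans.
apply/and3P; split.
- apply/allrelP => i j; rewrite mem_rev !mem_filter /chi_prec => /andP[/negbTE-> _] /andP[-> _].
  by [].
- apply: (@sub_in_sorted _ (fun i => ~~ is_right (chi i)) (fun i j => i < j)).
  + by move=> i j; rewrite /chi_prec /in_mem/= => /negbTE-> _ ->; rewrite orbT.
  + by apply/allP => i; rewrite mem_filter => /andP[].
  + exact: sorted_filter.
- rewrite rev_sorted.
  apply: (@sub_in_sorted _ (fun i => is_right (chi i)) (fun i j => i < j)).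
  + by move=> i j; rewrite /chi_prec /in_mem/= => -> -> ->.
  + by apply/allP => i; rewrite mem_filter => /andP[].
  + exact: sorted_filter.
Qed.

Lemma chi_ltE : chi_lt chi =2 chi_prec.
Proof.
have H i j : chi_lt chi i j -> chi_prec i j.
  rewrite /chi_lt => ij.
  by apply: (sorted_ltn_index chi_prec_trans chi_seq_sorted); rewrite ?mem_chi_seq.
move=> i j; apply/idP/idP => [/H//|cij].
rewrite /chi_lt ltnNge; apply/negP; rewrite leq_eqVlt => /orP[/eqP e|/H ji].
  have ji : j = i := index_inj i (mem_chi_seq j) (mem_chi_seq i) e.
  by move: cij; rewrite ji chi_prec_irr.
by move: (chi_prec_asym ji); rewrite cij.
Qed.

End ChiOrder.

Section RelativePartitions.
Import boot.fintype boot.finset.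
Local Open Scope set_scope.
Local Open Scope nat_scope.
Variables (n : nat) (chi : 'I_n -> face).
Implicit Types (p q s : {set {set 'I_n}}) (V W U : {set 'I_n}).

Lemma chi_noncrossingP p :
  reflect (forall V W, V \in p -> W \in p -> V != W -> forall a b c d,
             a \in V -> b \in W -> c \in V -> d \in W ->
             chi_prec chi a b -> chi_prec chi b c -> chi_prec chi c d -> False)
          (chi_noncrossing chi p).
Proof.
apply: (iffP forall_inP) => [H V W Vp Wp VW a b c d aV bW cV dW ab bc cd|H V Vp].
  have /forall_inP/(_ _ Wp)/implyP/(_ VW) := H _ Vp.
  move=> /forall_inP/(_ _ aV)/forall_inP/(_ _ bW)/forall_inP/(_ _ cV)/forall_inP/(_ _ dW).
  by rewrite !chi_ltE ab bc cd.
apply/forall_inP => W Wp; apply/implyP => VW.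
apply/forall_inP => a aV; apply/forall_inP => b bW.
apply/forall_inP => c cV; apply/forall_inP => d dW.
by rewrite !chi_ltE; apply/negP => /and3P[]; exact: H VW _ _ _ _ aV bW cV dW.
Qed.

(** Relative to D, only the central positions lying in D can obstruct a block. *)
Definition interval_on (D : {set 'I_n}) p : bool :=
  [forall V in p, forall i in V, forall k in V, forall j in D,
    [&& (i < j)%N, (j < k)%N & is_center (chi j)] ==> (j \in V)].

Lemma interval_onP (D : {set 'I_n}) p :
  reflect (forall V, V \in p -> forall i j k : 'I_n, i \in V -> k \in V -> j \in D ->
             i < j -> j < k -> is_center (chi j) -> j \in V)
          (interval_on D p).
Proof.
apply: (iffP forall_inP) => [H V Vp i j k iV kV jD ij jk cj|H V Vp].
  have /forall_inP/(_ _ iV)/forall_inP/(_ _ kV)/forall_inP/(_ _ jD) := H _ Vp.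
  by rewrite ij jk cj.
apply/forall_inP => i iV; apply/forall_inP => k kV; apply/forall_inP => j jD.
by apply/implyP => /and3P[]; exact: H Vp _ _ _ iV kV jD.
Qed.

Definition ibnc_on (D : {set 'I_n}) p : bool :=
  [&& partition p D, chi_noncrossing chi p & interval_on D p].

Lemma is_ibnc_on p : is_ibnc chi p = ibnc_on [set: 'I_n] p.
Proof.
congr [&& _, _ & _]; apply: eq_forallb => V; congr (_ ==> _).
apply: eq_forallb => i; congr (_ ==> _); apply: eq_forallb => k; congr (_ ==> _).
by apply: eq_forallb => j; rewrite inE.
Qed.

Definition finer p s : bool := [forall U in p, exists V in s, U \subset V].

Lemma finerP p s :
  reflect (forall U, U \in p -> exists2 V, V \in s & U \subset V) (finer p s).
Proof. by apply: (iffP forall_inP) => H V /H /exists_inP. Qed.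

Lemma partition_block_uniq p D V W k :
  partition p D -> V \in p -> W \in p -> k \in V -> k \in W -> V = W.
Proof.
move=> /and3P[_ /trivIsetP tp _] Vp Wp kV kW; apply/eqP/negPn/negP => VW.
by have /pred0P/(_ k) := tp _ _ Vp Wp VW; rewrite /= kV kW.
Qed.

Lemma partition_block_ex p D U : partition p D -> U \in p -> exists k, k \in U.
Proof.
move=> /and3P[_ _ n0] Up; apply/set0Pn; apply: contra n0 => /eqP <-; exact: Up.
Qed.

Lemma partition_cover p D k : partition p D -> k \in D ->
  exists2 V, V \in p & k \in V.
Proof.
by move=> /and3P[/eqP <- _ _]; rewrite /cover => /bigcupP[V]; exists V.
Qed.

(** A crossing or an interval defect of p involving two blocks of s is excluded by s, and
    one inside a single block of s is excluded by the restriction of p to that block. *)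
Lemma ibnc_glue s p : ibnc_on setT s ->
  (ibnc_on setT p && finer p s) =
  (finer p s) && [forall V in s, ibnc_on V (p ::&: V)].
Proof.
move=> /and3P[ps /chi_noncrossingP ncs /interval_onP ints].
rewrite andbC; apply/andb_id2l => /finerP fin.
have tp V : (p ::&: V) = [set U in p | U \subset V] by [].
apply/idP/forall_inP.
  move=> /and3P[pp /chi_noncrossingP ncp /interval_onP intp] V Vs.
  apply/and3P; split.
  - have [_ tr n0] := and3P pp; apply/and3P; split.
    + rewrite eqEsubset; apply/andP; split.
        by apply/bigcupsP => U; rewrite inE => /andP[].
      apply/subsetP => k kV; have [U Up kU] := partition_cover pp (in_setT k).
      have [W Ws UW] := fin _ Up.
      have WV := partition_block_uniq ps Ws Vs (subsetP UW _ kU) kV.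
      by apply/bigcupP; exists U => //; rewrite inE Up -WV.
    + exact: trivIsetI.
    + by rewrite inE (negbTE n0).
  - by apply/chi_noncrossingP => U W; rewrite !inE => /andP[Up _] /andP[Wp _]; exact: ncp.
  - apply/interval_onP => U; rewrite inE => /andP[Up _] i j k iU kU _.
    exact: intp Up _ _ _ iU kU (in_setT j).
move=> H; apply/and3P; split.
- apply/and3P; split.
  + rewrite eqEsubset subsetT; apply/subsetP => k _.
    have [V Vs kV] := partition_cover ps (in_setT k).
    have /and3P[pV _ _] := H _ Vs; have [U] := partition_cover pV kV.
    by rewrite inE => /andP[Up _] kU; apply/bigcupP; exists U.
  + apply/trivIsetP => U W Up Wp UW; apply/pred0P => k /=.
    apply/negP => /andP[kU kW]; have [V Vs UV] := fin _ Up.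
    have [V' Vs' WV'] := fin _ Wp.
    have E := partition_block_uniq ps Vs Vs' (subsetP UV _ kU) (subsetP WV' _ kW).
    have /and3P[pV _ _] := H _ Vs; move/eqP: UW; apply.
    by apply: (partition_block_uniq pV _ _ kU kW); rewrite inE ?Up ?Wp// E.
  + apply/negP => p0; have [V Vs _] := fin _ p0.
    by have /and3P[/and3P[_ _]] := H _ Vs; rewrite inE p0 sub0set.
- apply/chi_noncrossingP => U W Up Wp UW a b c d aU bW cU dW ab bc cd.
  have [V Vs UV] := fin _ Up; have [V' Vs' WV'] := fin _ Wp.
  have [E|VV'] := eqVneq V V'.
    have /and3P[_ /chi_noncrossingP nc _] := H _ Vs.
    by apply: (nc U W _ _ UW a b c d) => //; rewrite inE ?Up ?Wp// E.
  have [UV_ WV'_] := (subsetP UV, subsetP WV').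
  exact: ncs VV' _ _ _ _ (UV_ _ aU) (WV'_ _ bW) (UV_ _ cU) (WV'_ _ dW) ab bc cd.
- apply/interval_onP => U Up i j k iU kU _ ij jk cj.
  have [V Vs UV] := fin _ Up.
  have jV : j \in V by exact: (ints V Vs i j k (subsetP UV _ iU) (subsetP UV _ kU) (in_setT j)).
  have /and3P[_ _ /interval_onP iV] := H _ Vs.
  by apply: (iV U _ i j k) => //; rewrite inE Up.
Qed.

End RelativePartitions.

(** * Transport of partitions along increasing maps *)

Section Relabel.
Import boot.fintype boot.finset.
Local Open Scope set_scope.
Local Open Scope nat_scope.
Variables (m n : nat) (chi : 'I_n -> face) (e : 'I_m -> 'I_n).
Hypothesis e_mono : forall i j : 'I_m, (e i < e j) = (i < j).

Lemma relabel_inj : injective e.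
Proof.
move=> i j eij; apply/val_inj/eqP; rewrite eqn_leq.
by rewrite (leqNgt i j) (leqNgt j i) -!e_mono eij ltnn.
Qed.

Let chi' i := chi (e i).

Lemma chi_prec_relabel i j : chi_prec chi (e i) (e j) = chi_prec chi' i j.
Proof. by rewrite /chi_prec !e_mono. Qed.

Lemma enum_relabel (U : {set 'I_m}) : enum (e @: U) = [seq e i | i <- enum U].
Proof.
have tr : transitive (fun i j : 'I_n => i < j) by move=> ? ? ?; exact: ltn_trans.
apply: (irr_sorted_eq tr) => [i||| i]; first by rewrite ltnn.
- exact: sorted_enum_ltn.
- rewrite sorted_map (eq_sorted (e' := (fun i j : 'I_m => i < j))).
    exact: sorted_enum_ltn.
  by move=> i j /=; rewrite e_mono.
- rewrite mem_enum; apply/imsetP/mapP => -[j jU ->]; exists j => //.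
    by rewrite mem_enum.
  by move: jU; rewrite mem_enum.
Qed.

Definition relabel (p : {set {set 'I_m}}) : {set {set 'I_n}} :=
  [set e @: (U : {set 'I_m}) | U in p].

Lemma ibnc_relabel p : ibnc_on chi (e @: setT) (relabel p) = is_ibnc chi' p.
Proof.
have ei := relabel_inj; have si := imset_inj ei.
rewrite is_ibnc_on; congr [&& _, _ & _]; first exact: (imset_partition p _ ei).
- apply/idP/idP => /chi_noncrossingP H; apply/chi_noncrossingP => V W.
    move=> Vp Wp VW a b c d aV bW cV dW ab bc cd.
    apply: (H _ _ (imset_f _ Vp) (imset_f _ Wp) _ _ _ _ _
      (imset_f e aV) (imset_f e bW) (imset_f e cV) (imset_f e dW));
      by rewrite ?chi_prec_relabel// (inj_eq si).
  move=> /imsetP[V' Vp ->] /imsetP[W' Wp ->]; rewrite (inj_eq si) => VW a b c d.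
  move=> /imsetP[a' aV ->] /imsetP[b' bV ->] /imsetP[c' cV ->] /imsetP[d' dV ->].
  by rewrite !chi_prec_relabel; exact: (H V' W').
- apply/idP/idP => /interval_onP H; apply/interval_onP => V.
    move=> Vp i j k iV kV _ ij jk cj; rewrite -(mem_imset _ _ ei).
    apply: (H _ (imset_f _ Vp) (e i) (e j) (e k)); rewrite ?e_mono ?mem_imset//.
  move=> /imsetP[V' Vp ->] _ _ _ /imsetP[i iV ->] /imsetP[k kV ->] /imsetP[j _ ->].
  by rewrite !e_mono mem_imset// => ij jk cj; exact: (H V' Vp i j k iV kV (in_setT j) ij jk cj).
Qed.

(** An increasing map preserves both the natural order and, face by face, the chi-order;
    so the partitions of a block are those of an initial segment. *)
Lemma big_relabel (F : comNzRingType) (g : {set 'I_n} -> F) :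
  (\sum_(p | ibnc_on chi (e @: setT) p) \prod_(U in p) g U =
   \sum_(p | is_ibnc chi' p) \prod_(U in p) g (e @: U))%R.
Proof.
have ei := relabel_inj; have si := imset_inj ei.
pose h' (q : {set {set 'I_n}}) := [set e @^-1: (U : {set 'I_n}) | U in q].
have eK (U : {set 'I_m}) : e @^-1: (e @: U) = U.
  by apply/setP => i; rewrite inE mem_imset.
have hK p : h' (relabel p) = p.
  rewrite /h' /relabel -imset_comp (eq_imset (g := id)) ?imset_id//.
rewrite (reindex_onto relabel h') => [|p /and3P[pp _ _]].
  apply: eq_big => [p|p _]; first by rewrite hK eqxx andbT ibnc_relabel.
  by rewrite big_imset //= => U W _ _; exact: si.
rewrite /relabel /h' -imset_comp -[RHS]imset_id; apply: eq_in_imset => U Up /=.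
apply/setP => k; apply/imsetP/idP => [[i + ->]|kU]; first by rewrite inE.
have /imsetP[i _ ki] := subsetP (partitionS pp Up) _ kU.
by exists i => //; rewrite inE -ki.
Qed.

End Relabel.

Lemma big_ibnc n (chi : 'I_n -> face) (F : comNzRingType)
    (g : {set {set 'I_n}} -> F) :
  \sum_(s : IBNC chi) g s = \sum_(p | is_ibnc chi p) g p.
Proof.
rewrite (reindex_omap (fun s : IBNC chi => val s) insub) => [|p pp].
  by apply: eq_bigl => s; rewrite valK eqxx andbT (valP s).
by rewrite insubT.
Qed.

(** * Moments with prescribed cumulants *)

Section MomentCumulant.
Import boot.fintype boot.finset.
Local Open Scope set_scope.
Local Open Scope ring_scope.
Variables (F : fieldType) (I J K : choiceType).
Local Notation L := (I + J + K)%type.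
Variable c : seq L -> F.

Definition block_weight n (w : 'I_n -> L) (p : {set {set 'I_n}}) : F :=
  \prod_(U in p) c [seq w l | l <- enum U].

(** The moment-cumulant formula read as a definition of moments from cumulants c. *)
Definition cmoment n (w : 'I_n -> L) : F :=
  \sum_(p | is_ibnc (fun i => face_of (w i)) p) block_weight w p.

Lemma cmoment_eq n (w w' : 'I_n -> L) : w =1 w' -> cmoment w = cmoment w'.
Proof. by move=> /funext ->. Qed.

Definition cmoment_word (s : seq L) : F := cmoment (tnth (in_tuple s)).

(** Reading a word off a map on 'I_n changes the index type to 'I_(size s), whose bound
    equals n only propositionally. *)
Lemma cmoment_wordE n (w : 'I_n -> L) : cmoment_word [seq w i | i <- enum 'I_n] = cmoment w.
Proof.
set s := [seq _ | _ <- _]; have sn : size s = n by rewrite size_map size_enum_ord.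
have : forall i : 'I_n, w i = nth (w i) s i.
  by move=> i; rewrite (nth_map i) ?size_enum_ord// nth_ord_enum.
move: s sn => s sn; case: _ / sn w => w ws; apply: cmoment_eq => i.
by rewrite (tnth_nth (w i)) /= -ws.
Qed.

Lemma enum_val_ltn n (V : {set 'I_n}) (i j : 'I_#|V|) :
  (enum_val i < enum_val j)%N = (i < j)%N.
Proof.
have H (a b : 'I_#|V|) : (a < b)%N -> (enum_val a < enum_val b)%N.
  have x0 := enum_val a; rewrite !(enum_val_nth x0) => ab.
  apply: (sorted_ltn_nth _ x0 (sorted_enum_ltn V)); rewrite ?inE -?cardE//.
  by move=> ? ? ?; exact: ltn_trans.
apply/idP/idP => [ij|]; last exact: H.
rewrite ltnNge leq_eqVlt; apply/negP => /orP[/eqP/val_inj ji|/H ji].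
  by rewrite ji ltnn in ij.
by have := ltn_trans ij ji; rewrite ltnn.
Qed.

Lemma cmoment_word_block n (w : 'I_n -> L) (V : {set 'I_n}) :
  cmoment_word [seq w i | i <- enum V] =
  \sum_(p | ibnc_on (fun i => face_of (w i)) V p) block_weight w p.
Proof.
pose e : 'I_#|V| -> 'I_n := enum_val.
have eV : [set e i | i in [set: 'I_#|V|]] = V.
  apply/setP => k; apply/imsetP/idP => [[i _ ->]|kV]; first exact: enum_valP.
  by exists (enum_rank_in kV k); rewrite ?inE// /e enum_rankK_in.
have -> : [seq w i | i <- enum V] = [seq w (e i) | i <- enum 'I_#|V|].
  rewrite (map_comp w e) -{1}eV (enum_relabel (@enum_val_ltn n V)); congr map.
  by congr map; apply: eq_enum => i; rewrite !inE.
rewrite cmoment_wordE -[in RHS]eV (big_relabel _ (@enum_val_ltn n V)).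
apply: eq_bigr => p _; apply: eq_bigr => U _; rewrite (enum_relabel (@enum_val_ltn n V)).
by rewrite -map_comp.
Qed.

(** Every block of p lies in exactly one block of s. *)
Lemma big_finer n (s p : {set {set 'I_n}}) (g : {set 'I_n} -> F) D :
  finset.partition s D -> finset.partition p D -> finer p s ->
  \prod_(V in s) \prod_(U in p ::&: V) g U = \prod_(U in p) g U.
Proof.
move=> ps pp /finerP fin.
rewrite (exchange_big_dep (fun U => U \in p))/=; last first.
  by move=> V U _; rewrite inE => /andP[].
apply: eq_bigr => U Up; have [V Vs UV] := fin _ Up.
rewrite (big_pred1 V)// => W; rewrite !inE Up /=.
apply/andP/eqP => [[Ws UW]|->//].
have [k kU] := partition_block_ex pp Up.
by apply: (partition_block_uniq ps Ws Vs (k := k)); [exact: (subsetP UW)|exact: (subsetP UV)].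
Qed.

(** Expanding the product of sums chooses a partition of each block of s; glueing these
    choices together is a bijection onto the partitions below s, whose inverse cuts a
    partition along the blocks of s. *)
Lemma prod_cmoment_blocks n (w : 'I_n -> L) (s : {set {set 'I_n}}) :
  is_ibnc (fun i => face_of (w i)) s ->
  \prod_(V in s) cmoment_word [seq w i | i <- enum V] =
  \sum_(p | is_ibnc (fun i => face_of (w i)) p && finer p s) block_weight w p.
Proof.
set chi := fun i => face_of (w i); rewrite is_ibnc_on => sI.
have /and3P[ps _ _] := sI.
under eq_bigr do rewrite cmoment_word_block.
rewrite (big_distr_big_dep set0)/=.
pose glue (f : {ffun {set 'I_n} -> {set {set 'I_n}}}) := \bigcup_(V in s) f V.
pose cut (p : {set {set 'I_n}}) := [ffun V => if V \in s then p ::&: V else set0].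
rewrite (reindex_onto cut glue) => [|f /pfamilyP[f0 fP]]; last first.
  apply/ffunP => V; rewrite ffunE; case: ifPn => Vs; last first.
    by symmetry; apply/eqP; apply: contraNT Vs => fV; apply: (subsetP f0).
  apply/setP => U; rewrite inE; apply/andP/idP => [[/bigcupP[W Ws UW] UV]|UV].
    have /and3P[pW _ _] := fP _ Ws; have [k kU] := partition_block_ex pW UW.
    have kW := subsetP (partitionS pW UW) _ kU.
    by rewrite (partition_block_uniq ps Vs Ws (subsetP UV _ kU) kW).
  have /and3P[pV _ _] := fP _ Vs.
  by split; [apply/bigcupP; exists V|exact: partitionS pV UV].
apply: eq_big => [p|p].
  rewrite is_ibnc_on ibnc_glue// andbC.
  have -> : (glue (cut p) == p) = finer p s.
    apply/eqP/finerP => [<- U /bigcupP[V Vs]|fin].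
      by rewrite ffunE Vs inE => /andP[_ UV]; exists V.
    apply/setP => U; apply/bigcupP/idP => [[V Vs]|Up].
      by rewrite ffunE Vs inE => /andP[].
    by have [V Vs UV] := fin _ Up; exists V => //; rewrite ffunE Vs inE Up.
  congr (_ && _); apply/pfamilyP/forall_inP => [[_ H] V Vs|H].
    by have := H V Vs; rewrite ffunE Vs.
  split=> [|V Vs]; last by rewrite ffunE Vs; exact: H.
  by apply/subsetP => V; rewrite inE/= ffunE; case: ifP => // _; rewrite eqxx.
move=> /andP[/pfamilyP[_ H] /eqP gp].
have fin : finer p s.
  apply/finerP => U; rewrite -{1}gp => /bigcupP[V Vs].
  by rewrite ffunE Vs inE => /andP[_ UV]; exists V.
have pI : ibnc_on chi setT p.
  have := ibnc_glue p sI; rewrite fin andbT => ->; apply/forall_inP => V Vs.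
  by have := H V Vs; rewrite ffunE Vs.
have /and3P[pp _ _] := pI.
rewrite [in RHS]/block_weight -(big_finer _ ps pp fin); apply: eq_bigr => V Vs.
by rewrite ffunE Vs.
Qed.

(** After exchanging the sums over s and over p below s, the Moebius sums above p vanish
    unless p is the one-block partition. *)
Lemma moebius_cmoment n (w : 'I_n.+1 -> L) (chi := fun i => face_of (w i)) :
  \sum_(s : IBNC chi) (moebius s (ibnc1 chi))%:~R *
     \prod_(V in ibnc_val s) cmoment_word [seq w i | i <- enum V] =
  c [seq w i | i <- enum 'I_n.+1].
Proof.
transitivity (\sum_(s : IBNC chi) \sum_(p : IBNC chi | (p <= s)%O)
   (moebius s (ibnc1 chi))%:~R * block_weight w p).
  apply: eq_bigr => s _; rewrite -mulr_sumr; congr (_ * _).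
  rewrite prod_cmoment_blocks; last by case: s.
  by rewrite big_mkcondr /= -big_ibnc [RHS]big_mkcond.
rewrite (exchange_big_dep predT)//=.
under eq_bigr do rewrite -mulr_suml -(raddf_sum (intr : int -> F)) moebius_sumr.
rewrite (bigD1 (ibnc1 chi))//= eqxx mul1r big1 ?addr0.
  rewrite /block_weight big_set1; congr (c [seq _ | _ <- _]).
  by apply: eq_enum => i; rewrite !inE.
by move=> p /negbTE ->; rewrite mul0r.
Qed.

End MomentCumulant.

(** The cumulants of a central limit law: C in order two, zero otherwise. *)
Definition pair_cumulant (F : fieldType) (L : Type) (C : L -> L -> F) (s : seq L) : F :=
  if s is [:: k; l] then C k l else 0.

Section GammaMoments.
Variables (F : fieldType) (I J K : choiceType).
Local Notation L := (I + J + K)%type.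
Variable C : L -> L -> F.

Definition cmoment_fun : ncpoly F L -> F :=
  malg_lift (fun m : {fmonom L} => cmoment_word (pair_cumulant C) m : F^o).

Fact cmoment_fun_linear : scalar cmoment_fun.
Proof. exact: (@malg_lift_linear F {fmonom L} F^o). Qed.

HB.instance Definition _ :=
  GRing.isLinear.Build F (ncpoly F L) F *%R cmoment_fun cmoment_fun_linear.

Lemma cmoment_funE s : cmoment_fun << FMonom s >> = cmoment_word (pair_cumulant C) s.
Proof. exact: (malg_liftU (Y := F^o)). Qed.

Lemma kappa_cmoment_fun n (w : 'I_n.+1 -> L) :
  kappa cmoment_fun (fun i => face_of (w i)) (fun i => ncvar F (w i)) =
  (pair_cumulant C) [seq w i | i <- enum 'I_n.+1].
Proof.
rewrite -moebius_cmoment; apply: eq_bigr => s _; congr (_ * _).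
by apply: eq_bigr => V _; rewrite prod_block cmoment_funE.
Qed.

Lemma cmoment_word_nil : cmoment_word (pair_cumulant C) [::] = 1.
Proof.
rewrite /cmoment_word /cmoment (big_pred1 finset.set0) => [|p].
  by rewrite /block_weight finset.big_set0.
have no (V : {set 'I_0}) : V = finset.set0 by apply/setP => -[].
rewrite is_ibnc_on; apply/idP/eqP => [/and3P[/and3P[_ _ p0] _ _]|->].
  by apply/setP => V; rewrite (no V) (negbTE p0) finset.in_set0.
apply/and3P; split.
- apply/and3P; split; last by rewrite finset.in_set0.
    by rewrite /finset.cover finset.big_set0 (no [set: _]%SET).
  by apply/finset.trivIsetP => V W; rewrite finset.in_set0.
- by apply/chi_noncrossingP => V W; rewrite finset.in_set0.
- by apply/interval_onP => V; rewrite finset.in_set0.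
Qed.

Lemma cmoment_word_pair k l : cmoment_word (pair_cumulant C) [:: k; l] = C k l.
Proof.
pose w : 'I_2 -> L := tnth (in_tuple [:: k; l]).
have E (V : {set 'I_2}) : #|V| = 1%N -> (pair_cumulant C) [seq w i | i <- enum V] = 0.
  by rewrite cardE => /eqP; rewrite -(size_map w); case: [seq _ | _ <- _] => [|? []].
rewrite /cmoment_word -[cmoment _ _]/(cmoment (pair_cumulant C) w) /cmoment -big_ibnc.
rewrite (bigD1 (ibnc1 _))//= big1 ?addr0 => [|s s1].
  rewrite /block_weight big_set1 (_ : [seq _ | _ <- _] = [:: k; l])//.
  rewrite (@eq_enum _ _ 'I_2) => [|i]; last by rewrite !inE.
  by rewrite /w enum_ordSl enum_ordSl enum_ord0 /= !(tnth_nth k).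
have ps := ibnc_partition s.
have [V Vs i0] := partition_cover ps (finset.in_setT ord0).
rewrite /block_weight (bigD1 V)//= E ?mul0r//.
have := ibnc_block_lt s1 Vs; have : (0 < #|V|)%N by apply/card_gt0P; exists ord0.
by case: #|V| => [|[]].
Qed.

Lemma cmoment_fun_Gamma : is_Gamma C cmoment_fun.
Proof.
split=> [|k l|n w n2].
- have := prod_ncvar F ([::] : seq L); rewrite big_nil => ->; exact: etrans (cmoment_funE _) cmoment_word_nil.
- have := prod_ncvar F [:: k; l]; rewrite !big_cons big_nil mulr1 => ->.
  exact: etrans (cmoment_funE _) (cmoment_word_pair k l).
- rewrite kappa_cmoment_fun; have : size [seq w i | i <- enum 'I_n.+1] <> 2%N.
    by rewrite size_map size_enum_ord.
  by case: [seq _ | _ <- _] => [|? [|? []]].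
Qed.

(** Gamma is the only central limit law with covariance C, and cmoment_fun is one. *)
Lemma Gamma_monom s : Gamma C << FMonom s >> = cmoment_word (pair_cumulant C) s.
Proof. by rewrite (Gamma_unique (GammaP C) cmoment_fun_Gamma); exact: cmoment_funE. Qed.

End GammaMoments.

(** * Face operators on elementary tensors *)

Section FaceOperators.
Variables (F : fieldType) (I : choiceType) (X : I -> pvect F).
Implicit Types (w s t : seq (letter X)) (i j : I) (u v : rfp X)
  (Q : pred (seq (letter X))).

Definition face_action (f : face) i (T : {linear X i -> X i}) : rfp X -> rfp X :=
  match f with
  | Lface => lambda T
  | Rface => rho T
  | Cface => fun v => P_proj i (lambda T (P_proj i v))
  end.

Fact face_action_linear f i (T : {linear X i -> X i}) : linear (face_action f T).
Proof.
case: f => a u v /=; first exact: lambda_linear; first exact: rho_linear.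
by rewrite P_proj_linear lambda_linear P_proj_linear.
Qed.

HB.instance Definition _ f i (T : {linear X i -> X i}) :=
  GRing.isLinear.Build F (rfp X) (rfp X) *:%R (face_action f T) (face_action_linear f T).

Lemma face_action0 f i (T : {linear X i -> X i}) : face_action f T 0 = 0.
Proof. exact: linear0. Qed.

Lemma vac_coef_linear : linear (@vac_coef F I X).
Proof. exact: rfp_lift_linear (@vac_coef_multilinear F I X). Qed.

HB.instance Definition _ :=
  GRing.isLinear.Build F (rfp_space X) F^o *:%R (@vac_coef F I X) vac_coef_linear.

Lemma vac_coef_tens w : vac_coef (tens w) = (admissible w && (w == [::]))%:R.
Proof.
have [aw|naw] := boolP (admissible w); last by rewrite tens_nadm// linear0.
by rewrite /vac_coef (rfp_liftE (@vac_coef_multilinear F I X)).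
Qed.

(** The functional of the pointed space rfp X is defined by choice; vac_coef computes it. *)
Lemma pv_fun_rfp u : pv_fun (rfp X) u = vac_coef u.
Proof.
have /vac_coef_ker := pv_projP u; rewrite /pv_proj linearB linearZ/=.
move/eqP; rewrite subr_eq0 => /eqP ->; rewrite vac_coef_tens/=.
by rewrite /GRing.scale/= mulr1.
Qed.

Definition tens_span (Q : pred (seq (letter X))) : set (rfp X) :=
  Defs.span [set tens w | w in [set w | Q w]].

Lemma tens_spanP Q : is_subspace (tens_span Q).
Proof. exact: Defs.span_subspace. Qed.

Lemma tens_span_tens Q w : Q w -> tens_span Q (tens w).
Proof. by move=> Qw; apply: Defs.sub_span; exists w. Qed.

Lemma tens_span_map Q Q' (g : {linear rfp X -> rfp X}) :
  (forall w, admissible w -> Q w -> tens_span Q' (g (tens w))) ->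
  forall u, tens_span Q u -> tens_span Q' (g u).
Proof.
move=> H u Qu.
have sQ := tens_spanP Q'.
suff S : [set M | is_subspace M /\ [set tens w | w in [set w | Q w]] `<=` M]
    [set u | tens_span Q' (g u)] by exact: (Qu _ S).
split; first split => [|a x y /= xQ yQ].
- by rewrite /= linear0; exact: sQ.1.
- by rewrite /= linearP; exact: sQ.2.
- move=> _ [w Qw <-] /=; have [aw|naw] := boolP (admissible w); first exact: H.
  by rewrite tens_nadm// linear0; exact: sQ.1.
Qed.

Lemma tens_span_sub Q Q' : (forall w, Q w -> Q' w) ->
  forall u, tens_span Q u -> tens_span Q' u.
Proof.
move=> QQ'; apply: (tens_span_map (g := idfun)) => w _ /QQ'.
exact: tens_span_tens.
Qed.

(** An operator of index i only creates, changes or deletes a letter of index i, so what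
    is left of a word after deleting such letters is invariant. *)
Definition strip i w : seq (letter X) := [seq a <- w | tag a != i].

Lemma V_map_strip i (x : X i) t :
  tens_span (fun w => strip i w == strip i t) (V_map x t).
Proof.
apply: (subspaceD (tens_spanP _)).
  by apply: (subspaceZ _ (tens_spanP _)); exact: tens_span_tens.
by apply: tens_span_tens; rewrite /strip /= eqxx.
Qed.

Lemma W_map_strip i (x : X i) t :
  tens_span (fun w => strip i w == strip i t) (W_map t x).
Proof.
apply: (subspaceD (tens_spanP _)).
  by apply: (subspaceZ _ (tens_spanP _)); exact: tens_span_tens.
by apply: tens_span_tens; rewrite /strip filter_rcons /= eqxx.
Qed.

Lemma V_inv_strip i w : strip i (V_inv i w).2 = strip i w.
Proof.
by case: w => //= a t; rewrite /strip/=; case: eqVneq => //= ai; rewrite ai.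
Qed.

Lemma W_inv_strip i w : strip i (W_inv i w).1 = strip i w.
Proof.
case/lastP: w => // t a; rewrite W_inv_rcons /strip filter_rcons.
by case: ifP => //= ai; rewrite filter_rcons ai.
Qed.

Lemma lambda_tens i (T : {linear X i -> X i}) w : admissible w ->
  lambda T (tens w) = V_map (T (V_inv i w).1) (V_inv i w).2.
Proof.
by move=> aw; rewrite /lambda (rfp_liftE (lambda_multilinear T))//; case: V_inv.
Qed.

Lemma rho_tens i (T : {linear X i -> X i}) w : admissible w ->
  rho T (tens w) = W_map (W_inv i w).1 (T (W_inv i w).2).
Proof.
by move=> aw; rewrite /rho (rfp_liftE (rho_multilinear T))//; case: W_inv.
Qed.

Lemma P_proj_tens i w : admissible w ->
  P_proj i (tens w) =
  if all (fun a : letter X => tag a == i) w && (size w <= 1)%N then tens w else 0.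
Proof. by move=> aw; rewrite /P_proj (rfp_liftE (@P_proj_multilinear F I X i)). Qed.

HB.instance Definition _ i :=
  GRing.isLinear.Build F (rfp X) (rfp X) *:%R (@P_proj F I X i) (@P_proj_linear F I X i).
HB.instance Definition _ i (T : {linear X i -> X i}) :=
  GRing.isLinear.Build F (rfp X) (rfp X) *:%R (lambda T) (lambda_linear T).
HB.instance Definition _ i (T : {linear X i -> X i}) :=
  GRing.isLinear.Build F (rfp X) (rfp X) *:%R (rho T) (rho_linear T).

Lemma face_action_strip f i (T : {linear X i -> X i}) s u :
  tens_span (fun w => strip i w == s) u ->
  tens_span (fun w => strip i w == s) (face_action f T u).
Proof.
have hP : forall u, tens_span (fun w => strip i w == s) u ->
    tens_span (fun w => strip i w == s) (P_proj i u).
  apply: tens_span_map => w aw ws; rewrite /= P_proj_tens//.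
  by case: ifP => _; [exact: tens_span_tens|exact: (tens_spanP _).1].
have hL : forall u, tens_span (fun w => strip i w == s) u ->
    tens_span (fun w => strip i w == s) (lambda T u).
  apply: tens_span_map => w aw /eqP <-; rewrite /= lambda_tens// -V_inv_strip.
  exact: V_map_strip.
case: f => /=; [exact: hL| |by move=> /hP/hL/hP].
apply: (tens_span_map (g := rho T)) => w aw /eqP <-; rewrite /= rho_tens// -W_inv_strip.
exact: W_map_strip.
Qed.

Definition has_index j w := has (fun a : letter X => tag a == j) w.

Lemma has_index_strip i j w : j != i -> has_index j (strip i w) = has_index j w.
Proof.
move=> ji; rewrite /has_index /strip; elim: w => //= a w IH.
by case: (eqVneq (tag a) i) => [->|_] /=; rewrite IH// eq_sym (negbTE ji).
Qed.

Lemma face_action_has_index f i (T : {linear X i -> X i}) j u : j != i ->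
  tens_span (has_index j) u -> tens_span (has_index j) (face_action f T u).
Proof.
move=> ji; apply: tens_span_map => w aw wj.
apply: (@tens_span_sub (fun w' => strip i w' == strip i w)).
  by move=> w' /eqP E; rewrite -(has_index_strip _ ji) E has_index_strip.
by apply: face_action_strip; exact: tens_span_tens.
Qed.

Lemma face_action_no_index f i (T : {linear X i -> X i}) j u : j != i ->
  tens_span (fun w => ~~ has_index j w) u ->
  tens_span (fun w => ~~ has_index j w) (face_action f T u).
Proof.
move=> ji; apply: tens_span_map => w aw wj.
apply: (@tens_span_sub (fun w' => strip i w' == strip i w)).
  by move=> w' /eqP E; rewrite -(has_index_strip _ ji) E has_index_strip.
by apply: face_action_strip; exact: tens_span_tens.
Qed.

(** The vacuum coefficient only sees the empty word. *)
Lemma vac_coef_tens_span Q u : ~~ Q [::] -> tens_span Q u -> vac_coef u = 0.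
Proof.
move=> Q0 Qu; suff S : [set M | is_subspace M /\
   [set tens w | w in [set w | Q w]] `<=` M]
    [set u | vac_coef u = 0] by exact: (Qu _ S).
split; first split => [|a x y /= x0 y0].
- by rewrite /= linear0.
- by rewrite /= linearP /= x0 y0 scaler0 addr0.
- move=> _ [w Qw <-] /=; rewrite vac_coef_tens; case: eqVneq Qw => [-> Qn|_ _]; last by rewrite andbF.
  by case/negP: Q0.
Qed.

Lemma pv_proj_centered i (x : X i) : pv_fun (X i) x = 0 -> pv_proj x = x.
Proof. by rewrite /pv_proj => ->; rewrite scale0r subr0. Qed.

Lemma pv_ker_centered i (x : X i) : pv_fun (X i) x = 0 -> pv_ker x.
Proof. by move=> x0; rewrite -(pv_proj_centered x0); exact: pv_projP. Qed.

(** On a word without the index i the operator meets the vacuum vector of X i, and being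
    centred it creates a letter and nothing else.  A central operator does so only on the
    empty word, since its projection kills every other word avoiding i. *)
Lemma face_action_fresh f i (T : {linear X i -> X i}) w :
  pv_fun (X i) (T (pv_vec (X i))) = 0 ->
  admissible w -> ~~ has_index i w ->
  face_action f T (tens w) =
  match f with
  | Lface => tens (lett (T (pv_vec (X i))) :: w)
  | Rface => tens (rcons w (lett (T (pv_vec (X i)))))
  | Cface => if w == [::] then tens [:: lett (T (pv_vec (X i)))] else 0
  end.
Proof.
move=> T0 aw wi.
have Vw : V_inv i w = (pv_vec (X i), w).
  by case: w wi {aw} => //= a w; rewrite negb_or => /andP[/negbTE-> _].
have Ww : W_inv i w = (w, pv_vec (X i)).
  case/lastP: w wi {aw Vw} => // w a; rewrite W_inv_rcons /has_index -cats1 has_cat/=.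
  by rewrite orbF negb_or => /andP[_ /negbTE ->].
have Lw : lambda T (tens w) = tens (lett (T (pv_vec (X i))) :: w).
  by rewrite lambda_tens// Vw /= /V_map T0 scale0r add0r pv_proj_centered.
case: f => //=.
- by rewrite rho_tens// Ww /= /W_map T0 scale0r add0r pv_proj_centered.
- rewrite P_proj_tens//; case: eqVneq => [w0|w0].
    subst w; rewrite /= Lw P_proj_tens//= ?eqxx//.
    by rewrite /admissible/= (introT (asboolP _) (pv_ker_centered T0)).
  case: w w0 wi {aw Vw Ww Lw} => //= a w _; rewrite negb_or => /andP[/negbTE-> _] /=.
  by rewrite !linear0.
Qed.

(** The copy of X i inside the free product: the line of xi plus the one-letter words. *)
Definition emb i (x : X i) : rfp X := V_map x [::].

Lemma embE i (x : X i) : emb x = pv_fun (X i) x *: tens [::] + tens [:: lett (pv_proj x)].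
Proof. by []. Qed.

Lemma admissible1 i (x : X i) : pv_ker x -> admissible [:: lett x].
Proof. by move=> kx; rewrite /admissible/= (introT (asboolP _) kx). Qed.

Lemma P_proj_emb i (x : X i) : P_proj i (emb x) = emb x.
Proof.
rewrite embE linearP/= !P_proj_tens//= ?eqxx//.
by apply: admissible1; exact: pv_projP.
Qed.

(** The three kinds of operators agree on the copy of X i, so the moments in a single
    index are computed inside X i. *)
Lemma face_action_emb f i (T : {linear X i -> X i}) (x : X i) : face_action f T (emb x) = emb (T x).
Proof.
have L : lambda T (emb x) = emb (T x) := @lambdaE F I X i T x [::] isT isT.
case: f => /=; [exact: L|exact: (@rhoE F I X i T x [::] isT isT)|].
by rewrite P_proj_emb L P_proj_emb.
Qed.

Lemma emb_vec i : emb (pv_vec (X i)) = tens [::].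
Proof. exact: V_map_vec. Qed.

Lemma vac_coef_emb i (x : X i) : vac_coef (emb x) = pv_fun (X i) x.
Proof.
rewrite embE linearP/= !vac_coef_tens/= /GRing.scale/= mulr1.
by rewrite andbF addr0.
Qed.

End FaceOperators.

(** * Mixed moments in the free product *)

Section FreeProductMoments.
Variables (F : fieldType) (X : nat -> pvect F) (L : choiceType) (fc : L -> face).
Variable T : forall i, L -> {linear X i -> X i}.
Implicit Types (i j : nat) (l : L) (r : seq L) (s : seq (nat * L)).

Definition moment_vec i r : X i := foldr (fun l (x : X i) => T i l x) (pv_vec (X i)) r.
Definition mom i r : F := pv_fun (X i) (moment_vec i r).
Definition op (a : nat * L) : rfp X -> rfp X := face_action (fc a.2) (T a.1 a.2).
Definition state s : rfp X := foldr op (tens [::] : rfp X) s.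
Definition mixed_mom s : F := vac_coef (state s).

HB.instance Definition _ (a : nat * L) := GRing.Linear.on (op a).

Lemma state_const i r : state [seq (i, l) | l <- r] = emb (moment_vec i r).
Proof.
elim: r => [|l r IH]; first by rewrite /moment_vec /= emb_vec.
by rewrite [LHS]/= -/(state _) IH /op face_action_emb.
Qed.

Lemma mixed_mom_const i r : mixed_mom [seq (i, l) | l <- r] = mom i r.
Proof. by rewrite /mixed_mom state_const vac_coef_emb. Qed.

Hypothesis centered : forall i l, mom i [:: l] = 0.

Lemma state_no_index i s : i \notin unzip1 s ->
  tens_span (fun w => ~~ has_index i w) (state s).
Proof.
elim: s => [|[j l] s IH]; first by move=> _; exact: tens_span_tens.
rewrite inE negb_or => /andP[ij /IH]; exact: face_action_no_index.
Qed.

Lemma state_has_index i s (u : rfp X) : i \notin unzip1 s ->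
  tens_span (has_index i) u -> tens_span (has_index i) (foldr op u s).
Proof.
elim: s => [//|[j l] s IH].
rewrite inE negb_or => /andP[ij si] /(IH si); exact: face_action_has_index.
Qed.

(** The operators to the right of the singleton produce words avoiding i, the singleton
    adds a letter i, and the operators to its left cannot delete it. *)
Lemma mixed_mom_singleton i l s1 s2 : i \notin unzip1 s1 -> i \notin unzip1 s2 ->
  mixed_mom (s1 ++ (i, l) :: s2) = 0.
Proof.
move=> i1 i2; apply: (@vac_coef_tens_span _ _ _ (has_index i)) => //.
rewrite /state foldr_cat; apply: state_has_index => //=.
move: (state_no_index i2); apply: tens_span_map => w aw wi.
rewrite /= /op /= face_action_fresh//; last exact: centered.
case: (fc l).
- by apply: tens_span_tens; rewrite /has_index /= eqxx.
- by apply: tens_span_tens; rewrite /has_index has_rcons /= eqxx.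
- case: ifP => _; last exact: (tens_spanP _).1.
  by apply: tens_span_tens; rewrite /has_index /= eqxx.
Qed.

End FreeProductMoments.

(** * A bound on mixed moments that is uniform in the indices *)

Section UniformBound.
Variables (F : numFieldType) (X : nat -> pvect F) (L : choiceType) (fc : L -> face).
Variable T : forall i, L -> {linear X i -> X i}.
Variables (D : pred L) (N : nat) (M : F).
Hypothesis M0 : 0 <= M.
Hypothesis momM : forall i r, (size r <= N)%N -> all D r -> `|mom T i r| <= M.

(** The letters that q operators can create: centred parts of words of length at most q
    applied to the vacuum vector. *)
Definition moment_letter (q : nat) (a : letter X) : Prop :=
  exists2 r, (size r <= q)%N && all D r & a = lett (pv_proj (moment_vec T (tag a) r)).

Definition moment_word q (w : seq (letter X)) : Prop :=
  forall s a t, w = s ++ a :: t -> moment_letter q a.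

(** moment_bounded q c u: u is a combination of elementary tensors of moment letters whose
    coefficients have absolute values summing to at most c.  An inductive presentation
    avoids choosing a representation of u, which is not unique. *)
Inductive moment_bounded (q : nat) : F -> rfp X -> Prop :=
| moment_bounded0 : moment_bounded q 0 0
| moment_bounded_tens w : moment_word q w -> moment_bounded q 1 (tens w)
| moment_boundedD c1 c2 u1 u2 : moment_bounded q c1 u1 -> moment_bounded q c2 u2 ->
    moment_bounded q (c1 + c2) (u1 + u2)
| moment_boundedZ a c u : moment_bounded q c u -> moment_bounded q (`|a| * c) (a *: u)
| moment_bounded_le c1 c2 u : c1 <= c2 -> moment_bounded q c1 u -> moment_bounded q c2 u.

Lemma moment_bounded_vac q c u : moment_bounded q c u -> `|vac_coef u| <= c.
Proof.
elim=> [|w _|c1 c2 u1 u2 _ H1 _ H2|a c' u' _ H|c1 c2 u' c12 _ H].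
- by rewrite linear0 normr0.
- by rewrite vac_coef_tens; case: (_ && _); rewrite ?normr1 ?normr0.
- by rewrite linearD; apply: le_trans (ler_normD _ _) _; exact: lerD.
- by rewrite linearZ /= /GRing.scale/= normrM ler_wpM2l.
- exact: le_trans H c12.
Qed.

(** A linear map is controlled by its values on elementary tensors. *)
Lemma moment_bounded_map q q' K (g : {linear rfp X -> rfp X}) : 0 <= K ->
  (forall w, admissible w -> moment_word q w -> moment_bounded q' K (g (tens w))) ->
  forall c u, moment_bounded q c u -> moment_bounded q' (K * c) (g u).
Proof.
move=> K0 H c u; elim=> {c u} [|w qw|c1 c2 u1 u2 _ H1 _ H2|a c' u' _ H'|c1 c2 u' c12 _ H'].
- by rewrite mulr0 linear0; exact: moment_bounded0.
- rewrite mulr1; have [aw|naw] := boolP (admissible w); first exact: H.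
  by rewrite tens_nadm// linear0; apply: moment_bounded_le (moment_bounded0 _).
- by rewrite mulrDr linearD; exact: moment_boundedD.
- by rewrite mulrCA linearZ; exact: moment_boundedZ.
- by apply: moment_bounded_le H'; rewrite ler_wpM2l.
Qed.

Lemma moment_letterW q q' a : (q <= q')%N -> moment_letter q a -> moment_letter q' a.
Proof. by move=> qq' [r /andP[rq rD] ->]; exists r; rewrite ?(leq_trans rq). Qed.

Lemma moment_wordP q w :
  moment_word q w <-> forall a, a \in w -> moment_letter q a.
Proof.
split=> [H a aw|H s a t E]; last by apply: H; rewrite E mem_cat inE eqxx orbT.
by case/splitPr: aw H => s t H; exact: H.
Qed.

Lemma moment_wordW q q' w : (q <= q')%N -> moment_word q w -> moment_word q' w.
Proof.
by move=> qq' /moment_wordP H; apply/moment_wordP => a /H; exact: moment_letterW.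
Qed.

Lemma moment_word_cons q i r t : (size r <= q)%N -> all D r -> moment_word q t ->
  moment_word q (lett (pv_proj (moment_vec T i r)) :: t).
Proof.
move=> rq rD /moment_wordP H; apply/moment_wordP => a.
rewrite inE => /orP[/eqP ->|/H//]; by exists r => //; rewrite rq.
Qed.

Lemma moment_word_rcons q i r t : (size r <= q)%N -> all D r -> moment_word q t ->
  moment_word q (rcons t (lett (pv_proj (moment_vec T i r)))).
Proof.
move=> rq rD /moment_wordP H; apply/moment_wordP => a.
rewrite mem_rcons inE => /orP[/eqP ->|/H//]; by exists r => //; rewrite rq.
Qed.

Let K : F := (M + 1) ^+ 2.

Lemma moment_bounded_V_map q i r t : (size r <= q)%N -> (q <= N)%N -> all D r -> moment_word q t ->
  moment_bounded q (M + 1) (V_map (moment_vec T i r) t).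
Proof.
move=> rq qN rD tq; apply: moment_boundedD; last by apply: moment_bounded_tens; exact: moment_word_cons.
apply: (moment_bounded_le (c1 := `|mom T i r| * 1)); first by rewrite mulr1 momM// (leq_trans rq).
by apply: moment_boundedZ; exact: moment_bounded_tens.
Qed.

Lemma moment_bounded_W_map q i r t : (size r <= q)%N -> (q <= N)%N -> all D r -> moment_word q t ->
  moment_bounded q (M + 1) (W_map t (moment_vec T i r)).
Proof.
move=> rq qN rD tq; apply: moment_boundedD; last by apply: moment_bounded_tens; exact: moment_word_rcons.
apply: (moment_bounded_le (c1 := `|mom T i r| * 1)); first by rewrite mulr1 momM// (leq_trans rq).
by apply: moment_boundedZ; exact: moment_bounded_tens.
Qed.

(** The two shapes of the vector met by an operator are the vacuum vector and a letter
    v - f(v) xi; both have the form v - a xi with a bounded by M. *)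
Definition moment_factor q i (x : X i) : Prop :=
  exists r a, [/\ (size r <= q)%N, all D r, `|a| <= M & x = moment_vec T i r - a *: moment_vec T i [::]].

Lemma moment_letter_vector q i (a : letter X) : (q <= N)%N -> moment_letter q a ->
  tag a = i -> moment_factor q (tagged_as (lett (pv_vec (X i))) a).
Proof.
move=> qN + ai; case: a ai => j x /= ji [r /andP[rq rD] /= ax]; subst j.
rewrite tagged_asE; exists r, (mom T i r); split=> //; first by rewrite momM// (leq_trans rq).
by move/eqP: ax; rewrite -[existT _ _ _]/(Tagged X x) eq_Tagged => /eqP.
Qed.

Lemma moment_factor_vec q i : moment_factor q (pv_vec (X i)).
Proof. by exists [::], 0; split=> //; rewrite ?normr0// scale0r subr0. Qed.

Lemma V_inv_moment q i w : (q <= N)%N -> moment_word q w ->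
  moment_factor q (V_inv i w).1 /\ moment_word q (V_inv i w).2.
Proof.
move=> qN; case: w => [|a t] wq; first by split=> //=; exact: moment_factor_vec.
have /moment_wordP H := wq; rewrite /V_inv; case: eqVneq => ai /=; last first.
  by split=> //; exact: moment_factor_vec.
split; first by apply: moment_letter_vector => //; apply: H; rewrite mem_head.
by apply/moment_wordP => b bt; apply: H; rewrite inE bt orbT.
Qed.

Lemma W_inv_moment q i w : (q <= N)%N -> moment_word q w ->
  moment_factor q (W_inv i w).2 /\ moment_word q (W_inv i w).1.
Proof.
move=> qN; case/lastP: w => [|t a] wq; first by split=> //=; exact: moment_factor_vec.
have /moment_wordP H := wq; rewrite W_inv_rcons; case: eqVneq => ai /=; last first.
  by split=> //; exact: moment_factor_vec.
split; first by apply: moment_letter_vector => //; apply: H; rewrite mem_rcons mem_head.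
by apply/moment_wordP => b bt; apply: H; rewrite mem_rcons inE bt orbT.
Qed.

Let M1 : 1 <= M + 1. Proof. by rewrite lerDr. Qed.

(** Applying T to v - a xi gives two moment vectors, with coefficients 1 and a, and each
    splits into its vacuum part and its centred part: the total is (1 + M) (1 + M). *)
Lemma moment_bounded_T q i l (g : {linear X i -> rfp X}) (x : X i) : (q < N)%N -> D l ->
  (forall r, (size r <= q.+1)%N -> all D r -> moment_bounded q.+1 (M + 1) (g (moment_vec T i r))) ->
  moment_factor q x -> moment_bounded q.+1 K (g (T i l x)).
Proof.
move=> qN lD H [r [a [rq rD aM ->]]].
rewrite linearB linearZ linearB linearZ/= -scaleNr.
apply: (moment_bounded_le (c1 := (M + 1) + `|- a| * (M + 1))).
  rewrite -[X in X + _]mul1r -mulrDl /K expr2 ler_wpM2r ?(le_trans ler01)//.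
  by rewrite addrC lerD2r normrN.
apply: moment_boundedD; first by apply: (H (l :: r)) => //=; rewrite lD.
by apply: moment_boundedZ; apply: (H [:: l]) => //=; rewrite lD.
Qed.

Definition V_mapr i t (x : X i) : rfp X := V_map x t.

HB.instance Definition _ i t :=
  GRing.isLinear.Build F (X i) (rfp X) *:%R (@V_mapr i t) (@V_map_linear F _ X i t).
HB.instance Definition _ i t :=
  GRing.isLinear.Build F (X i) (rfp X) *:%R (W_map t) (@W_map_linear F _ X i t).

Lemma moment_bounded_op q c u a : (q < N)%N -> D a.2 ->
  moment_bounded q c u -> moment_bounded q.+1 (K * c) (op fc T a u).
Proof.
case: a => i l /= qN lD; have K0 : 0 <= K by rewrite exprn_ge0// (le_trans ler01).
have qN' := ltnW qN.
have hP q' : forall c u, moment_bounded q' c u -> moment_bounded q' c (P_proj i u).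
  move=> c' u' H'; rewrite -[c']mul1r; apply: moment_bounded_map H' => // w aw wq.
  rewrite /= P_proj_tens//; case: ifP => _; first exact: moment_bounded_tens.
  by apply: moment_bounded_le (moment_bounded0 _).
have hL : forall c u, moment_bounded q c u -> moment_bounded q.+1 (K * c) (lambda (T i l) u).
  apply: moment_bounded_map => // w aw wq; rewrite /= lambda_tens//.
  have [vx wt] := V_inv_moment i qN' wq.
  apply: (moment_bounded_T (g := @V_mapr i _)) vx => // r rq rD.
  by apply: moment_bounded_V_map => //; apply: moment_wordW wt.
rewrite /op /=; case: (fc l) => /=; [exact: hL| |by move=> /hP/hL/hP].
apply: (moment_bounded_map (g := rho (T i l))) => // w aw wq; rewrite /= rho_tens//.
have [vx wt] := W_inv_moment i qN' wq.
apply: (moment_bounded_T (g := W_map _)) vx => // r rq rD.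
by apply: moment_bounded_W_map => //; apply: moment_wordW wt.
Qed.

(** Each operator multiplies the bound by K, whatever its index. *)
Lemma mixed_mom_bound (s : seq (nat * L)) : (size s <= N)%N -> all D (unzip2 s) ->
  `|mixed_mom fc T s| <= K ^+ size s.
Proof.
move=> sN sD; apply: (@moment_bounded_vac (size s)).
elim: s sN sD => [|a s IH] sN sD.
  by apply: moment_bounded_tens => -[].
move: sD => /= /andP[aD sD]; rewrite exprS; apply: moment_bounded_op => //.
by apply: IH => //; exact: ltnW.
Qed.

End UniformBound.

(** * Pairings and the double-ended queue *)

Section Pairing.
Import boot.fintype boot.finset.
Local Open Scope set_scope.
Local Open Scope nat_scope.
Variables (n : nat) (chi : 'I_n -> face) (mate : 'I_n -> 'I_n).
Hypothesis mateK : involutive mate.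
Hypothesis mate_neq : forall k, mate k != k.
Implicit Types a b c d k : 'I_n.

Definition pairing : {set {set 'I_n}} := [set [set k; mate k] | k in 'I_n & k < mate k].

Lemma pairing_block k : [set k; mate k] \in pairing.
Proof.
have := mate_neq k; rewrite -(inj_eq val_inj) neq_ltn => /orP[mk|km].
  by apply/imsetP; exists (mate k); rewrite ?inE mateK//= setUC.
by apply/imsetP; exists k; rewrite ?inE.
Qed.

Lemma pairingP V : reflect (exists k, V = [set k; mate k]) (V \in pairing).
Proof.
apply: (iffP idP) => [/imsetP[k _ ->]|[k ->]]; first by exists k.
exact: pairing_block.
Qed.

Lemma mem_pairing_block V k : V \in pairing -> k \in V -> V = [set k; mate k].
Proof.
by move=> /pairingP[j ->]; rewrite !inE => /orP[] /eqP -> //; rewrite mateK setUC.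
Qed.

Lemma pairing_partition : partition pairing [set: 'I_n].
Proof.
apply/and3P; split.
- rewrite eqEsubset subsetT; apply/subsetP => k _; apply/bigcupP.
  by exists [set k; mate k]; [exact: pairing_block|rewrite !inE eqxx].
- apply/trivIsetP => V W Vp Wp VW; apply/pred0P => k /=; apply/negP => /andP[kV kW].
  by move/eqP: VW; apply; rewrite (mem_pairing_block Vp kV) (mem_pairing_block Wp kW).
- by apply/negP => /pairingP[k /setP/(_ k)]; rewrite !inE eqxx.
Qed.

(** Positions are treated from the last to the first.  The pairs (mate b, b) enclosing k
    are those whose factor is present when k is treated: a central k needs none, and if k
    closes the pair (k, mate k), the factor of mate k must be the one at the end of the
    queue on which k acts. *)
Definition deque_ok k : bool :=
  [forall b : 'I_n, (k < b) && (mate b < k) ==>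
    ~~ is_center (chi k) && ((k < mate k) ==>
      if is_right (chi k) then chi_prec chi b (mate k) else chi_prec chi (mate k) b)].

Lemma deque_okP k :
  reflect (forall b, k < b -> mate b < k -> ~~ is_center (chi k) /\
      (k < mate k -> if is_right (chi k) then chi_prec chi b (mate k) else chi_prec chi (mate k) b))
    (deque_ok k).
Proof.
apply: (iffP forallP) => [H b kb bk|H b].
  by have := H b; rewrite kb bk /= => /andP[-> /implyP].
by apply/implyP => /andP[kb bk]; have [-> ?] := H b kb bk; apply/implyP.
Qed.

(** The smallest of four positions is an extremity for the chi-order.  Hence two crossing
    pairs x < y and u < v with x < u satisfy u < y, and when u is treated the factor of y
    stands between u and the factor of v. *)
Lemma deque_ok_nested a b c d : mate a = c -> mate b = d ->
  (forall k, deque_ok k) ->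
  chi_prec chi a b -> chi_prec chi b c -> chi_prec chi c d -> False.
Proof.
move=> ac bd ok Hab Hbc Hcd.
have neq (x y : 'I_n) : chi_prec chi x y -> (x : nat) <> y.
  by move=> xy /val_inj E; rewrite E chi_prec_irr in xy.
have := neq _ _ Hab; have := neq _ _ Hbc; have := neq _ _ Hcd.
have := neq _ _ (chi_prec_trans Hab (chi_prec_trans Hbc Hcd)).
have /eqP := mate_neq a; have /eqP := mate_neq b; rewrite ac bd.
move=> /(contra_not (@val_inj _ _ _ d b)) + /(contra_not (@val_inj _ _ _ c a)).
move: Hab Hbc Hcd.
have ca : mate c = a by rewrite -ac mateK.
have db : mate d = b by rewrite -bd mateK.
have H (x y : 'I_n) : x < y -> mate y < x -> x < mate x ->
    if is_right (chi x) then chi_prec chi y (mate x) else chi_prec chi (mate x) y.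
  by move=> xy yx; have [_] := deque_okP _ (ok x) y xy yx.
move: (H a b) (H a d) (H c b) (H c d) (H b a) (H b c) (H d a) (H d c).
rewrite ac bd ca db /chi_prec.
case: (is_right (chi a)); case: (is_right (chi b)); case: (is_right (chi c));
  case: (is_right (chi d)) => //=; lia.
Qed.

(** A pair enclosing a central position violates the interval condition, and a factor
    that is not at the required end of the queue belongs to a pair crossing (k, mate k). *)
Lemma pairing_ibnc_ok : is_ibnc chi pairing = [forall k, deque_ok k].
Proof.
rewrite is_ibnc_on; apply/idP/forallP; last first.
  move=> ok; apply/and3P; split; first exact: pairing_partition.
  - apply/chi_noncrossingP => V W Vp Wp VW a b c d aV bW cV dW ab bc cd.
    have neq (x y : 'I_n) : chi_prec chi x y -> (y == x) = false.
      by move=> xy; apply/negP => /eqP E; rewrite E chi_prec_irr in xy.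
    have ac : mate a = c.
      move: cV; rewrite (mem_pairing_block Vp aV) !inE.
      by rewrite (neq _ _ (chi_prec_trans ab bc)) => /eqP.
    have bd : mate b = d.
      move: dW; rewrite (mem_pairing_block Wp bW) !inE.
      by rewrite (neq _ _ (chi_prec_trans bc cd)) => /eqP.
    exact: deque_ok_nested ac bd ok ab bc cd.
  - apply/interval_onP => V Vp i j k iV kV _ ij jk cj.
    have ik : mate k = i.
      move: iV; rewrite (mem_pairing_block Vp kV) !inE => /orP[/eqP E|/eqP//].
      by rewrite -E ltnNge (ltnW ij) in jk.
    have := deque_okP _ (ok j) k jk; rewrite ik => /(_ ij)[].
    by rewrite cj.
move=> /and3P[_ /chi_noncrossingP nc /interval_onP int] k; apply/deque_okP => b kb bk.
have NB x : x \in [set b; mate b] -> k != x.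
  by rewrite !inE => /orP[] /eqP ->; rewrite -(inj_eq val_inj) neq_ltn ?kb ?bk ?orbT.
split.
  apply/negP => ck.
  have : k \in [set b; mate b].
    apply: (int _ (pairing_block b) (mate b) k b) => //; rewrite !inE ?eqxx ?orbT//.
  by move/NB; rewrite eqxx.
have VW : [set k; mate k] != [set b; mate b].
  apply/negP => /eqP E; have : k \in [set k; mate k] by rewrite !inE eqxx.
  by rewrite E => /NB; rewrite eqxx.
have [kV mkV] : k \in [set k; mate k] /\ mate k \in [set k; mate k].
  by rewrite !inE !eqxx orbT.
have [bW mbW] : b \in [set b; mate b] /\ mate b \in [set b; mate b].
  by rewrite !inE !eqxx orbT.
(* Both orders of the two blocks, so that either may contain the smallest position. *)
have {}nc x y : chi_prec chi x y -> forall z t,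
    (x \in [set k; mate k] -> y \in [set b; mate b] ->
    z \in [set k; mate k] -> t \in [set b; mate b] -> chi_prec chi y z -> chi_prec chi z t -> False)
   /\ (x \in [set b; mate b] -> y \in [set k; mate k] ->
    z \in [set b; mate b] -> t \in [set k; mate k] -> chi_prec chi y z -> chi_prec chi z t -> False).
  move=> xy z t; split=> h1 h2 h3 h4 h5 h6.
    exact: nc (pairing_block k) (pairing_block b) VW _ _ _ _ h1 h2 h3 h4 xy h5 h6.
  rewrite eq_sym in VW.
  exact: nc (pairing_block b) (pairing_block k) VW _ _ _ _ h1 h2 h3 h4 xy h5 h6.
move=> kd.
have bd : b != mate k by apply/negP => /eqP E; move: VW; rewrite E mateK setUC eqxx.
have nk : (k : nat) <> b by move=> E; rewrite E ltnn in kb.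
have tot := chi_prec_total chi bd.
(* In each case the partner of b closes a crossing, on the side given by its face. *)
set d := mate k in kd mkV bd tot *; set a := mate b in bk mbW *.
case: ifP => rk; apply/negPn/negP => /negbTE bd'; rewrite bd' ?orbF /= in tot.
  have [ra|ra] := boolP (is_right (chi a)).
    apply: (proj1 (nc d b tot k a)) => //; rewrite /chi_prec ?rk ?ra//=.
    by move: bd'; rewrite /chi_prec; case: (is_right (chi b)); rewrite ?kb.
  apply: (proj2 (nc a d _ b k)) => //; rewrite /chi_prec ?rk ?(negbTE ra)//=.
    by rewrite (ltn_trans bk kd) orbT.
  by case: (is_right (chi b)); rewrite ?kb.
have kltb : chi_prec chi k b by rewrite /chi_prec rk kb orbT.
have [ra|ra] := boolP (is_right (chi a)).
  apply: (proj1 (nc k b kltb d a)) => //.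
  by rewrite /chi_prec ra (ltn_trans bk kd); case: (is_right (chi d)).
apply: (proj2 (nc a k _ b d)) => //.
by rewrite /chi_prec (negbTE ra) bk orbT.
Qed.

End Pairing.

Section OpenPositions.
Variables (n : nat) (chi : 'I_n -> face) (mate : 'I_n -> 'I_n).
Hypothesis mateK : involutive mate.
Implicit Types (a b d k : 'I_n) (m : nat) (s t : seq 'I_n).
Local Open Scope nat_scope.

(** The queue once the positions from m on have been treated: those whose partner is still
    to come, in chi-order. *)
Definition open_pos m : seq 'I_n := [seq b : 'I_n <- chi_seq chi | (m <= b) && (mate b < m)].

Lemma mem_open_pos b m : (b \in open_pos m) = (m <= b) && (mate b < m).
Proof. by rewrite mem_filter mem_chi_seq andbT. Qed.

Lemma open_pos_sorted m : sorted (chi_prec chi) (open_pos m).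
Proof. exact: (sorted_filter (@chi_prec_trans _ chi) _ (chi_seq_sorted chi)). Qed.

(** A strictly sorted sequence is determined by its elements, so the queue can be updated
    by comparing memberships. *)
Lemma open_pos_ext m s : sorted (chi_prec chi) s ->
  (forall b : 'I_n, (b \in s) = (m <= b) && (mate b < m)) -> open_pos m = s.
Proof.
move=> ss H; apply: (irr_sorted_eq (@chi_prec_trans _ chi) (@chi_prec_irr _ chi) (open_pos_sorted m) ss).
by move=> b; rewrite mem_open_pos H.
Qed.

Lemma chi_prec_cons k s : sorted (chi_prec chi) (k :: s) =
  all (chi_prec chi k) s && sorted (chi_prec chi) s.
Proof. exact: (path_sortedE (@chi_prec_trans _ chi)). Qed.

Lemma chi_prec_rcons k s : sorted (chi_prec chi) (rcons s k) =
  all (fun b => chi_prec chi b k) s && sorted (chi_prec chi) s.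
Proof.
have tr := @chi_prec_trans _ chi.
by rewrite !(sorted_pairwise tr) -cats1 pairwise_cat /= andbT allrel1r.
Qed.

Lemma mate_valE b k : (val (mate b) == val k) = (b == mate k).
Proof. by rewrite (inj_eq val_inj) -(inj_eq (inv_inj mateK)) mateK. Qed.

Lemma open_pos_opening k b : mate k < k ->
  (k <= b) && (mate b < k) = (b == k) || (b \in open_pos k.+1).
Proof.
move=> mk; rewrite mem_open_pos; have [->|bk] := eqVneq b k; first by rewrite leqnn mk.
have := mate_valE b k; move: bk; rewrite -!(inj_eq val_inj) /=; lia.
Qed.

Lemma open_pos_closing k b : k < mate k ->
  (k <= b) && (mate b < k) = (b != mate k) && (b \in open_pos k.+1).
Proof.
move=> mk; rewrite mem_open_pos.
have := mate_valE b k; have [->|] := eqVneq b k; first by rewrite -!(inj_eq val_inj)/=; lia.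
by rewrite -!(inj_eq val_inj) /=; lia.
Qed.

Lemma open_pos_opening_left k : mate k < k -> ~~ is_right (chi k) -> open_pos k = k :: open_pos k.+1.
Proof.
move=> mk rk; apply: open_pos_ext => [|b]; last by rewrite inE open_pos_opening.
rewrite chi_prec_cons open_pos_sorted andbT; apply/allP => b; rewrite mem_open_pos => /andP[kb _].
by rewrite /chi_prec (negbTE rk) kb orbT.
Qed.

Lemma open_pos_opening_right k : mate k < k -> is_right (chi k) -> open_pos k = rcons (open_pos k.+1) k.
Proof.
move=> mk rk; apply: open_pos_ext => [|b]; last by rewrite mem_rcons inE open_pos_opening.
rewrite chi_prec_rcons open_pos_sorted andbT; apply/allP => b; rewrite mem_open_pos => /andP[kb _].
by rewrite /chi_prec rk kb /=; case: is_right.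
Qed.

Lemma mate_in_open_pos k : k < mate k -> mate k \in open_pos k.+1.
Proof. by move=> mk; rewrite mem_open_pos mk mateK ltnSn. Qed.

Lemma open_pos_other k b : k < mate k -> b \in open_pos k.+1 -> b != mate k -> k < b /\ mate b < k.
Proof.
move=> mk; rewrite mem_open_pos => bo bk.
by have := open_pos_closing b mk; rewrite mem_open_pos bo bk /=; lia.
Qed.

Lemma open_pos_closing_left k t : k < mate k -> open_pos k.+1 = mate k :: t -> open_pos k = t.
Proof.
move=> mk E; have := open_pos_sorted k.+1; rewrite E chi_prec_cons => /andP[/allP dt st].
apply: open_pos_ext => // b; rewrite open_pos_closing// E inE.
case: eqVneq => [->|//] /=; apply/negP => /dt; by rewrite chi_prec_irr.
Qed.

Lemma open_pos_closing_right k t : k < mate k -> open_pos k.+1 = rcons t (mate k) -> open_pos k = t.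
Proof.
move=> mk E; have := open_pos_sorted k.+1; rewrite E chi_prec_rcons => /andP[/allP dt st].
apply: open_pos_ext => // b; rewrite open_pos_closing// E mem_rcons inE.
case: eqVneq => [->|//] /=; apply/negP => /dt; by rewrite chi_prec_irr.
Qed.

Lemma deque_ok_opening k : mate k < k ->
  deque_ok chi mate k = (is_center (chi k) ==> (open_pos k.+1 == [::])).
Proof.
move=> mk; apply/deque_okP/implyP => [H ck|H b kb bk].
  case E: (open_pos k.+1) => [//|b t]; have : b \in open_pos k.+1 by rewrite E mem_head.
  rewrite mem_open_pos => /andP[kb bk].
  have bk' : mate b < k.
    have := mate_valE b k; rewrite -(inj_eq val_inj) /=; lia.
  by have [] := H b kb bk'; rewrite ck.
split; last by lia.
apply/negP => /H /eqP E; have : b \in open_pos k.+1 by rewrite mem_open_pos kb (ltn_trans bk).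
by rewrite E.
Qed.

Lemma deque_ok_left k b t : k < mate k -> chi k = Lface -> open_pos k.+1 = b :: t ->
  deque_ok chi mate k = (b == mate k).
Proof.
move=> mk ck E; have := open_pos_sorted k.+1; rewrite E chi_prec_cons => /andP[/allP bt st].
apply/deque_okP/eqP => [H|bk].
  apply/eqP/negPn/negP => bk; have bo : b \in open_pos k.+1 by rewrite E mem_head.
  have [kb bk'] := open_pos_other mk bo bk.
  have [_ /(_ mk)] := H b kb bk'; rewrite ck /= => db.
  have := mate_in_open_pos mk; rewrite E inE eq_sym (negbTE bk) => /bt /chi_prec_asym.
  by rewrite db.
move=> b' kb' bk'; rewrite ck; split=> // _; subst b.
have : b' \in open_pos k.+1 by rewrite mem_open_pos kb' (ltn_trans bk').
rewrite E inE => /orP[/eqP E'|/bt//].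
by move: bk'; rewrite E' mateK ltnn.
Qed.

Lemma deque_ok_right k b t : k < mate k -> chi k = Rface -> open_pos k.+1 = rcons t b ->
  deque_ok chi mate k = (b == mate k).
Proof.
move=> mk ck E; have := open_pos_sorted k.+1; rewrite E chi_prec_rcons => /andP[/allP bt st].
apply/deque_okP/eqP => [H|bk].
  apply/eqP/negPn/negP => bk; have bo : b \in open_pos k.+1 by rewrite E mem_rcons mem_head.
  have [kb bk'] := open_pos_other mk bo bk.
  have [_ /(_ mk)] := H b kb bk'; rewrite ck /= => db.
  have := mate_in_open_pos mk; rewrite E mem_rcons inE eq_sym (negbTE bk) => /bt /chi_prec_asym.
  by rewrite db.
move=> b' kb' bk'; rewrite ck; split=> // _; subst b.
have : b' \in open_pos k.+1 by rewrite mem_open_pos kb' (ltn_trans bk').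
rewrite E mem_rcons inE => /orP[/eqP E'|/bt//].
by move: bk'; rewrite E' mateK ltnn.
Qed.

Lemma open_pos_uniq m : uniq (open_pos m).
Proof. exact: (sorted_uniq (@chi_prec_trans _ chi) (@chi_prec_irr _ chi) (open_pos_sorted m)). Qed.

Lemma deque_ok_center k : k < mate k -> chi k = Cface ->
  deque_ok chi mate k = (open_pos k.+1 == [:: mate k]).
Proof.
move=> mk ck; apply/deque_okP/eqP => [H|E b kb bk]; last first.
  have : b \in open_pos k.+1 by rewrite mem_open_pos kb (ltn_trans bk).
  by rewrite E inE => /eqP E'; move: bk; rewrite E' mateK ltnn.
have all_mate b : b \in open_pos k.+1 -> b = mate k.
  move=> bo; apply/eqP/negPn/negP => bk; have [kb bk'] := open_pos_other mk bo bk.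
  by have [] := H b kb bk'; rewrite ck.
have := mate_in_open_pos mk; have := open_pos_uniq k.+1.
case: (open_pos k.+1) all_mate => [//|b [|b' t]] am /=; first by rewrite (am b) ?mem_head.
by rewrite (am b) ?mem_head// (am b') ?inE ?eqxx ?orbT// eqxx.
Qed.

End OpenPositions.

(** * Mixed moments of pairings *)

Section PairState.
Variables (F : fieldType) (X : nat -> pvect F) (L : choiceType) (fc : L -> face).
Variable T : forall i, L -> {linear X i -> X i}.
Hypothesis centered : forall i l, mom T i [:: l] = 0.
Variables (n : nat) (w : 'I_n -> L) (f : 'I_n -> nat) (mate : 'I_n -> 'I_n).
Hypothesis mateK : involutive mate.
Hypothesis mate_neq : forall k, mate k != k.
Hypothesis f_mate : forall k, f (mate k) = f k.
Hypothesis f_fiber : forall j k, f j = f k -> j = k \/ j = mate k.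
Implicit Types (j k b : 'I_n) (m : nat).

Let chi k := fc (w k).
Let ok := deque_ok chi mate.
Local Notation open_pos := (open_pos chi mate).

Let vac i : X i := pv_vec (X i).
Definition open_letter b : letter X := lett (T (f b) (w b) (vac (f b))).
Definition open_word m : seq (letter X) := [seq open_letter b | b <- open_pos m].

Definition pair_state m : rfp X :=
  state fc T [seq (f k, w k) | k <- drop m (enum 'I_n)].

Definition step_weight k : F :=
  if ok k then (if (k < mate k)%N then mom T (f k) [:: w k; w (mate k)] else 1) else 0.

(** Words with a letter whose index is used by none of the positions before m: no later
    operator can delete that letter. *)
Definition dead m : pred (seq (letter X)) :=
  has (fun a => [forall j : 'I_n, (j < m)%N ==> (tag a != f j)]).

Lemma f_open_pos_inj m : {in open_pos m &, injective f}.
Proof.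
move=> b b'; rewrite !mem_open_pos => /andP[mb bm] /andP[mb' bm'] /f_fiber [//|E].
by move: bm; rewrite E mateK ltnNge mb'.
Qed.

Lemma centeredv i l : pv_fun (X i) (T i l (vac i)) = 0.
Proof. exact: centered. Qed.

Lemma open_word_admissible m : admissible (open_word m).
Proof.
apply/andP; split; last first.
  by rewrite all_map; apply/allP => b _; apply/asboolP; exact: pv_ker_centered (centeredv _ _).
rewrite sorted_map; apply: pairwise_sorted.
rewrite -(pairwise_map f (fun x y => x != y)) -uniq_pairwise map_inj_in_uniq.
  exact: open_pos_uniq.
exact: f_open_pos_inj.
Qed.

Lemma has_index_open i m : has_index i (open_word m) = (i \in map f (open_pos m)).
Proof.
rewrite /has_index has_map; apply/hasP/mapP => [[b bo /eqP <-]|[b bo ->]].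
  by exists b.
by exists b => //=.
Qed.

(** Both positions with index f k have been treated once k has. *)
Lemma dead_own k (s : seq (letter X)) : (k < mate k)%N -> has_index (f k) s -> dead k s.
Proof.
move=> km; apply: sub_has => a /eqP ->; apply/forallP => j; apply/implyP => jk.
apply/negP => /eqP/esym/f_fiber [E|E]; move: jk; rewrite E ?ltnn//.
by rewrite ltnNge (ltnW km).
Qed.

Lemma op_dead k u : tens_span (dead k.+1) u ->
  tens_span (dead k) (op fc T (f k, w k) u).
Proof.
apply: tens_span_map => s _ /hasP[a sa /forallP aP].
have ak : tag a != f k by have := aP k; rewrite ltnSn.
apply: (@tens_span_sub _ _ _ (has_index (tag a))) => [t|].
  apply: sub_has => a' /eqP ->; apply/forallP => j; apply/implyP => jk.
  by have /implyP := aP j; apply; exact: ltnW.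
apply: face_action_has_index => //; apply: tens_span_tens; apply/hasP; by exists a.
Qed.

Lemma face_action_center_nonempty (i : nat) (S : {linear X i -> X i}) (a b : letter X) s :
  face_action Cface S (tens (a :: b :: s)) = 0.
Proof.
have [aw|naw] := boolP (admissible (a :: b :: s)); last by rewrite tens_nadm// face_action0.
by rewrite /= P_proj_tens//= andbF !linear0.
Qed.

Lemma step_opening k : (mate k < k)%N ->
  op fc T (f k, w k) (tens (open_word k.+1)) = step_weight k *: tens (open_word k).
Proof.
move=> mk; have nk : (k < mate k)%N = false by rewrite ltnNge (ltnW mk).
have fresh : ~~ has_index (f k) (open_word k.+1).
  rewrite has_index_open; apply/mapP => -[b]; rewrite mem_open_pos => /andP[kb bk].
  move=> /f_fiber [E|E]; first by rewrite E ltnn in kb.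
  by move: mk; rewrite {1}E mateK ltnNge (ltnW kb).
rewrite /op face_action_fresh ?open_word_admissible//; last exact: centeredv.
rewrite /step_weight /ok deque_ok_opening// nk /=.
have left : ~~ is_right (chi k) -> open_word k = open_letter k :: open_word k.+1.
  by move=> rk; rewrite /open_word open_pos_opening_left.
case E : (fc (w k)); rewrite /chi E /=.
- by rewrite scale1r left// /chi E.
- by rewrite scale1r /open_word open_pos_opening_right /chi ?E// map_rcons.
- have -> : (open_word k.+1 == [::]) = (open_pos k.+1 == [::]) by rewrite /open_word; case: (open_pos k.+1).
  case: eqP => [e0|_]; last by rewrite scale0r.
  by rewrite scale1r left /chi ?E// /open_word e0.
Qed.

Lemma open_word_tag k b : (k < mate k)%N -> b \in open_pos k.+1 ->
  (f b == f k) = (b == mate k).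
Proof.
move=> mk; rewrite mem_open_pos => /andP[kb bk]; apply/eqP/eqP => [/f_fiber[E|//]|->//].
by rewrite E ltnn in kb.
Qed.

(** If the factor of mate k is at the end where k acts, it is replaced by T_k T_(mate k) xi,
    whose vacuum part is the covariance and whose centred part is dead; otherwise k
    creates a second letter of index f k, which is dead, or is killed by the projection. *)
Lemma step_closing k : (k < mate k)%N ->
  tens_span (dead k)
    (op fc T (f k, w k) (tens (open_word k.+1)) - step_weight k *: tens (open_word k)).
Proof.
move=> mk; set d := mate k.
have sP := tens_spanP (dead k).
have aw := open_word_admissible k.+1.
have dopn : d \in open_pos k.+1 by exact: mate_in_open_pos.
pose v : X (f k) := T (f k) (w d) (vac (f k)).
have letd : open_letter d = lett v by rewrite /open_letter /v /d f_mate.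
have own s : has_index (f k) s -> tens_span (dead k) (tens s).
  by move=> H; apply: tens_span_tens; exact: dead_own.
pose mm := mom T (f k) [:: w k; w d].
have mmE : pv_fun (X (f k)) (T (f k) (w k) v) = mm by [].
rewrite /step_weight /ok mk /op /=; case E : (fc (w k)).
- case ho : (open_pos k.+1) dopn => [//|b t] dopn.
  rewrite (deque_ok_left mateK (chi := chi) mk E ho) -/d.
  have bo : b \in open_pos k.+1 by rewrite ho mem_head.
  have wE : open_word k.+1 = open_letter b :: [seq open_letter b | b <- t].
    by rewrite /open_word ho.
  rewrite /= lambda_tens//; case: eqP => [bd|/eqP bd].
    have wk : open_word k = [seq open_letter b | b <- t].
      by rewrite /open_word (open_pos_closing_left mateK mk (t := t))// ho bd.
    rewrite wE bd letd V_inv_cons /= -wk /V_map mmE addrC addKr.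
    by apply: own; rewrite /has_index /= eqxx.
  rewrite scale0r subr0 wE /V_inv /= (open_word_tag mk bo) (negbTE bd) /=.
  rewrite /V_map centeredv scale0r add0r.
  by apply: own; rewrite /has_index /= eqxx.
- move ho: (open_pos k.+1) dopn => r dopn; case/lastP: r ho dopn => [//|t b] ho dopn.
  rewrite (deque_ok_right mateK (chi := chi) mk E ho) -/d.
  have bo : b \in open_pos k.+1 by rewrite ho mem_rcons mem_head.
  have wE : open_word k.+1 = rcons [seq open_letter b | b <- t] (open_letter b).
    by rewrite /open_word ho map_rcons.
  rewrite /= rho_tens//; case: eqP => [bd|/eqP bd].
    have wk : open_word k = [seq open_letter b | b <- t].
      by rewrite /open_word (open_pos_closing_right mateK mk (t := t))// ho bd.
    rewrite wE bd letd W_inv_rcons_lett /= -wk /W_map mmE addrC addKr.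
    by apply: own; rewrite /has_index has_rcons /= eqxx.
  rewrite scale0r subr0 wE W_inv_rcons /= (open_word_tag mk bo) (negbTE bd) /=.
  rewrite /W_map centeredv scale0r add0r.
  by apply: own; rewrite /has_index has_rcons /= eqxx.
- rewrite (deque_ok_center mateK (chi := chi) mk E) -/d.
  have [ho|od] := eqVneq (open_pos k.+1) [:: d].
    have wk : open_word k = [::].
      by rewrite /open_word (open_pos_closing_left mateK mk (t := [::])).
    have -> : tens (open_word k.+1) = emb v.
      rewrite embE /open_word ho /= letd pv_proj_centered; last exact: centeredv.
      by rewrite centeredv scale0r add0r.
    rewrite face_action_emb embE mmE wk addrC addKr.
    by apply: own; rewrite /has_index /= eqxx.
  rewrite scale0r subr0;
  suff -> : face_action Cface (T (f k) (w k)) (tens (open_word k.+1)) = 0 by exact: sP.1.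
  rewrite /open_word; case: (open_pos k.+1) od dopn => [//|b [|b' t]] od dopn.
    by move: od dopn; rewrite inE => bd /eqP db; rewrite db eqxx in bd.
  exact: face_action_center_nonempty.
Qed.

Lemma pair_state_dead m : (m <= n)%N ->
  tens_span (dead m)
    (pair_state m - (\prod_(k < n | (m <= k)%N) step_weight k) *: tens (open_word m)).
Proof.
move=> mn; have [q] := ubnP (n - m); elim: q m mn => // q IH m mn nq.
have [mE|mlt] := eqVneq m n.
  rewrite /pair_state drop_oversize ?size_enum_ord ?mE//= big_pred0.
    rewrite scale1r (_ : open_word n = [::]) ?subrr; first exact: (tens_spanP _).1.
    by rewrite /open_word (@open_pos_ext _ _ _ _ [::])// => b; rewrite leqNgt ltn_ord.
  by move=> k; rewrite leqNgt ltn_ord.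
have {mlt}mn' : (m < n)%N by rewrite ltn_neqAle mlt.
pose k : 'I_n := Ordinal mn'.
have stE : pair_state m = op fc T (f k, w k) (pair_state k.+1).
  have dE : drop m (enum 'I_n) = k :: drop k.+1 (enum 'I_n).
    rewrite (drop_nth k) ?size_enum_ord//; congr cons; exact: (nth_ord_enum k k).
  by rewrite /pair_state dE.
have prodE : \prod_(j < n | (m <= j)%N) step_weight j =
    step_weight k * \prod_(j < n | (k.+1 <= j)%N) step_weight j.
  rewrite (bigD1 k)//=; congr (_ * _); apply: eq_bigl => j.
  by rewrite ltn_neqAle andbC eq_sym -(inj_eq val_inj).
have := IH k.+1 mn'; rewrite -/k => /(_ _) IHk.
have {}IHk := IHk (leq_trans (ltn_sub2l mn' (ltnSn m)) nq).
set P := \prod_(j < n | _) _ in IHk; rewrite prodE -/P stE.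
have {}IHk := op_dead IHk.
set u := op _ _ _ (pair_state _); pose v := op fc T (f k, w k) (tens (open_word k.+1)).
have {}IHk : tens_span (dead k) (u - P *: v).
  by have := IHk; rewrite linearB linearZ.
have H : tens_span (dead k) (v - step_weight k *: tens (open_word k)).
  have := mate_neq k; rewrite -(inj_eq val_inj) neq_ltn => /orP[mk|mk].
    rewrite /v (step_opening mk) subrr; exact: (tens_spanP _).1.
  exact: (step_closing mk).
have -> : u - (step_weight k * P) *: tens (open_word m) =
  P *: (v - step_weight k *: tens (open_word k)) + (u - P *: v).
  rewrite scalerBr scalerA [RHS]addrC [RHS]addrA subrK [P * _]mulrC; reflexivity.
exact ((tens_spanP (dead k)).2 P _ _ H IHk).
Qed.

Lemma mixed_mom_pairs :
  mixed_mom fc T [seq (f k, w k) | k <- enum 'I_n] = \prod_(k < n) step_weight k.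
Proof.
have := pair_state_dead (leq0n n); rewrite /pair_state drop0.
have -> : open_word 0 = [::].
  by rewrite /open_word (@open_pos_ext _ _ _ _ [::])// => b; rewrite ltn0 andbF.
rewrite big_mkcond /= => H.
have : vac_coef (state fc T [seq (f k, w k) | k <- enum 'I_n]
    - (\prod_(k < n) step_weight k) *: tens [::]) = 0.
  exact: vac_coef_tens_span H.
rewrite linearB linearZ /= vac_coef_tens /= /GRing.scale /= mulr1 => /eqP.
by rewrite subr_eq0 => /eqP.
Qed.

End PairState.

(** * The sum over pair partitions attached to an index map *)

Section PairCumulantSum.
Import boot.fintype boot.finset.
Local Open Scope set_scope.
Local Open Scope ring_scope.
Variables (F : fieldType) (n : nat) (L : choiceType) (w : 'I_n -> L) (fc : L -> face).
Variable (mu : nat -> L -> L -> F).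
Implicit Types (f : 'I_n -> nat) (U V : {set 'I_n}) (p : {set {set 'I_n}}).

(** Pairs on which f is not constant get weight zero, so that a partition has a nonzero
    weight only if it consists of pairs inside fibres of f. *)
Definition block_cov f U : F :=
  if enum U is [:: a; b] then (if f a == f b then mu (f a) (w a) (w b) else 0) else 0.

Definition pair_sum f : F :=
  \sum_(p | is_ibnc (fun k => fc (w k)) p) \prod_(U in p) block_cov f U.

Lemma block_cov_neq0 f U : block_cov f U != 0 ->
  exists a b : 'I_n, [/\ (a < b)%N, U = [set a; b], f a = f b &
    block_cov f U = mu (f a) (w a) (w b)].
Proof.
rewrite /block_cov; case E: (enum U) => [|a [|b []]]; rewrite ?eqxx//.
case: (f a =P f b) => [fab _|_]; last by rewrite eqxx.
exists a, b; split=> //; first by have := sorted_enum_ltn U; rewrite E /= andbT.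
by apply/setP => k; rewrite -mem_enum E !inE.
Qed.

Lemma pair_sum_singleton f k : (forall j, f j = f k -> j = k) -> pair_sum f = 0.
Proof.
move=> fk; rewrite /pair_sum big1// => p; rewrite is_ibnc_on => /and3P[pp _ _].
have [U Up kU] := partition_cover pp (in_setT k).
apply/eqP; apply/prodf_eq0; exists U => //.
apply/negPn/negP => /block_cov_neq0[a [b [ab UE fab _]]].
move: kU; rewrite UE !inE => /orP[] /eqP kE; subst k.
  by rewrite (fk b) ?ltnn// in ab.
by rewrite (fk a) ?ltnn// in ab.
Qed.

Section Mate.
Variables (f : 'I_n -> nat) (mate : 'I_n -> 'I_n).
Hypothesis mateK : involutive mate.
Hypothesis mate_neq : forall k, mate k != k.
Hypothesis f_mate : forall k, f (mate k) = f k.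
Hypothesis f_fiber : forall j k, f j = f k -> j = k \/ j = mate k.

Lemma enum_pair (a b : 'I_n) : (a < b)%N -> enum [set a; b] = [:: a; b].
Proof.
move=> ab; have tr : transitive (fun i j : 'I_n => (i < j)%N) by move=> ? ? ?; exact: ltn_trans.
apply: (irr_sorted_eq tr) => [i|||i]; first by rewrite ltnn.
- exact: sorted_enum_ltn.
- by rewrite /= ab.
- by rewrite mem_enum !inE.
Qed.

Lemma prod_block_cov_pairing :
  \prod_(U in pairing mate) block_cov f U =
  \prod_(k < n | (k < mate k)%N) mu (f k) (w k) (w (mate k)).
Proof.
rewrite /pairing big_imset /= => [|j k].
  apply: eq_big => [k|k]; rewrite ?inE// => km.
  by rewrite /block_cov enum_pair// f_mate eqxx.
rewrite !inE => /= jm km /setP E.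
have := E j; have := E k; rewrite !inE !eqxx /= => /orP[/eqP//|/eqP kj].
move=> /esym/orP[/eqP//|/eqP jk].
by move: jm; rewrite -kj jk => kk; have := ltn_trans kk km; rewrite ltnn.
Qed.

(** When all fibres are pairs, the pairing by fibres is the only partition with a nonzero
    weight. *)
Lemma pair_sum_pairing :
  pair_sum f = if is_ibnc (fun k => fc (w k)) (pairing mate)
    then \prod_(k < n | (k < mate k)%N) mu (f k) (w k) (w (mate k)) else 0.
Proof.
have only p : is_ibnc (fun k => fc (w k)) p -> p != pairing mate ->
    \prod_(U in p) block_cov f U = 0.
  rewrite is_ibnc_on => /and3P[pp _ _] pm; apply/eqP; move: pm; apply: contraR => p0.
  have blk U k : U \in p -> k \in U -> U = [set k; mate k].
    move=> Up kU; have : block_cov f U != 0.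
      by apply: contra p0 => /eqP U0; apply/prodf_eq0; exists U => //; apply/eqP.
    move=> /block_cov_neq0[a [b [ab UE fab _]]].
    have ba : b = mate a.
      by case: (f_fiber (esym fab)) => // E; rewrite E ltnn in ab.
    move: kU; rewrite UE !inE => /orP[] /eqP ->; first by rewrite ba.
    by rewrite setUC ba mateK.
  apply/eqP/setP => U; apply/idP/idP => [Up|Um].
    have [k kU] := partition_block_ex pp Up.
    by rewrite (blk U k)//; exact: pairing_block.
  have [k kU] := partition_block_ex (pairing_partition mateK mate_neq) Um.
  have [V Vp kV] := partition_cover pp (in_setT k).
  by rewrite (mem_pairing_block mateK mate_neq Um kU) -(blk V k).
rewrite /pair_sum; case: ifP => I0.
  rewrite (bigD1 (pairing mate))//= prod_block_cov_pairing [X in _ + X]big1 ?addr0// => p /andP[].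
  exact: only.
by rewrite big1// => p pI; apply: only => //; apply/negP => /eqP E; rewrite E I0 in pI.
Qed.

End Mate.

End PairCumulantSum.

(** * Counting index maps *)

Section Fibers.
Import boot.fintype boot.finset.
Local Open Scope set_scope.
Local Open Scope nat_scope.
Variable n : nat.

Definition fiber (T : eqType) (f : 'I_n -> T) (k : 'I_n) : {set 'I_n} :=
  [set j | f j == f k].

Lemma fiber_mem (T : eqType) (f : 'I_n -> T) k : k \in fiber f k.
Proof. by rewrite inE. Qed.

Lemma fiber_gt0 (T : eqType) (f : 'I_n -> T) k : 0 < #|fiber f k|.
Proof. by apply/card_gt0P; exists k; exact: fiber_mem. Qed.

(** The fibres over the image partition [n], and the sum of their sizes exceeds twice
    their number. *)
Lemma card_image_lt (T : finType) (f : {ffun 'I_n -> T}) :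
  (forall k, 1 < #|fiber f k|) -> ~~ [forall k, #|fiber f k| == 2] ->
  #|f @: setT|.*2 < n.
Proof.
move=> f1 f2.
have En : n = \sum_(t in f @: setT) #|[set j | f j == t]|.
  rewrite -[n in LHS]card_ord -sum1_card (partition_big_imset f) /=.
  have -> : f @: 'I_n = f @: setT.
    by apply/setP => t; apply/imsetP/imsetP => -[k _ ->]; exists k.
  apply: eq_bigr => t _; rewrite -sum1_card; apply: eq_bigl => j; by rewrite inE.
have := @leqif_sum T [in f @: setT] (fun t => 2 == #|[set j | f j == t]|) (fun=> 2)
  (fun t => #|[set j | f j == t]|).
rewrite -En sum_nat_const muln2 => H.
have {H} [|le eq] := H.
  by move=> t /imsetP[k _ ->]; apply: leqif_eq; exact: f1.
rewrite ltn_neqAle le eq andbT; apply: contra f2 => /forall_inP H.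
by apply/forallP => k; rewrite eq_sym; apply: H; exact: imset_f.
Qed.

(** A map with at most q values factors through 'I_q. *)
Lemma card_small_image N q :
  #|[set f : {ffun 'I_n.+1 -> 'I_N} | #|f @: setT| <= q]| <= q ^ n.+1 * N ^ q.
Proof.
have -> : q ^ n.+1 * N ^ q = #|[set: {ffun 'I_n.+1 -> 'I_q} * {ffun 'I_q -> 'I_N}]|.
  by rewrite cardsT card_prod !card_ffun !card_ord.
apply: leq_trans (leq_imset_card
  (fun u : {ffun 'I_n.+1 -> 'I_q} * {ffun 'I_q -> 'I_N} => [ffun k => u.2 (u.1 k)]) _).
apply: subset_leq_card; apply/subsetP => f; rewrite inE => fq.
have f0 : f ord0 \in f @: setT by exact: imset_f.
pose g : {ffun 'I_n.+1 -> 'I_q} := [ffun k => widen_ord fq (enum_rank_in f0 (f k))].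
pose e : {ffun 'I_q -> 'I_N} := [ffun i : 'I_q => nth (f ord0) (enum (f @: setT)) i].
apply/imsetP; exists (g, e) => //; apply/ffunP => k; rewrite !ffunE /=.
by rewrite (nth_enum_rank_in (f ord0) f0)// imset_f.
Qed.

End Fibers.

Section SumOverBlocks.
Import boot.fintype boot.finset.
Local Open Scope set_scope.
Local Open Scope ring_scope.
Variables (F : fieldType) (n : nat) (L : choiceType) (w : 'I_n -> L).
Variables (mu : nat -> L -> L -> F) (N : nat).

(** The maps that contribute are constant on the blocks of p, hence amount to an
    independent choice of an index for each block. *)
Lemma sum_prod_block_cov (p : {set {set 'I_n}}) :
  partition p setT -> (forall U, U \in p -> #|U| = 2%N) ->
  \sum_(f : {ffun 'I_n -> 'I_N.+1}) \prod_(U in p) block_cov w mu (fun k => f k) U =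
  \prod_(U in p) \sum_(m < N.+1) pair_cumulant (mu m) [seq w l | l <- enum U].
Proof.
move=> pp p2.
pose j0 : 'I_N.+1 := ord0.
rewrite (big_distr_big_dep j0) /=.
pose spread (h : {ffun {set 'I_n} -> 'I_N.+1}) := [ffun k => h (pblock p k)].
(* j0 is the default value that pfamily prescribes outside p; on a block, f is read
   off at one of its points. *)
pose collect (f : {ffun 'I_n -> 'I_N.+1}) : {ffun {set 'I_n} -> 'I_N.+1} :=
  [ffun U => if U \in p then (if [pick k in U] is Some k then f k else j0) else j0].
have tp : trivIset p by have /and3P[] := pp.
have two U : U \in p -> exists a b, enum U = [:: a; b].
  by move=> /p2; rewrite cardE; case: (enum U) => [|a [|b []]]//; exists a, b.
rewrite (bigID (fun f : {ffun 'I_n -> 'I_N.+1} => spread (collect f) == f)) /=.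
rewrite [X in _ + X]big1 ?addr0 => [|f nf]; last first.
  apply/eqP; apply: contraR nf => p0; apply/eqP/ffunP => k; rewrite !ffunE.
  have [U Up kU] := partition_cover pp (in_setT k).
  rewrite (def_pblock tp Up kU) Up; case: pickP => [j jU|/(_ k)]; last by rewrite kU.
  have /block_cov_neq0[a [b [_ UE fab _]]] : block_cov w mu (fun k => f k) U != 0.
    by apply: contra p0 => /eqP U0; apply/prodf_eq0; exists U => //; apply/eqP.
  have {}fab : f a = f b by exact: val_inj.
  by move: jU kU; rewrite UE !inE => /orP[] /eqP -> /orP[] /eqP ->.
rewrite (reindex_onto spread collect) /=; last by move=> f /eqP.
apply: eq_big => [h|h /andP[_ /eqP ch]].
  have sc (ch : collect (spread h) = h) : spread (collect (spread h)) == spread h by rewrite ch.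
  apply/andP/pfamilyP => [[_ /eqP ch]|[h0 _]].
    split=> //; apply/subsetP => U; rewrite inE -ch ffunE.
    by case: ifP => //; rewrite eqxx.
  suff ch : collect (spread h) = h by split; [exact: sc|apply/eqP].
  apply/ffunP => U; rewrite ffunE; case: ifPn => Up; last first.
    by symmetry; apply/eqP; apply: contraNT Up => hU; apply: (subsetP h0); rewrite inE.
  case: pickP => [k kU|U0]; first by rewrite ffunE (def_pblock tp Up kU).
  by have [a [b E]] := two _ Up; have := U0 a; rewrite -mem_enum E mem_head.
apply: eq_bigr => U Up; have [a [b E]] := two _ Up.
have aU : a \in U by rewrite -mem_enum E mem_head.
have bU : b \in U by rewrite -mem_enum E !inE eqxx orbT.
by rewrite /block_cov E /= !ffunE (def_pblock tp Up aU) (def_pblock tp Up bU) eqxx.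
Qed.

End SumOverBlocks.

(** * Comparison of mixed moments with pair sums *)

Section MixedMomentsVersusPairs.
Import boot.fintype boot.finset.
Local Open Scope set_scope.
Local Open Scope ring_scope.
Variables (F : fieldType) (X : nat -> pvect F) (L : choiceType) (fc : L -> face).
Variable T : forall i, L -> {linear X i -> X i}.
Hypothesis centered : forall i l, mom T i [:: l] = 0.
Variables (n : nat) (w : 'I_n -> L).

Let mu i a b := mom T i [:: a; b].

Lemma mixed_mom_singleton_fiber (f : 'I_n -> nat) k : (forall j, f j = f k -> j = k) ->
  mixed_mom fc T [seq (f j, w j) | j <- enum 'I_n] = 0.
Proof.
move=> fk; have := mem_enum 'I_n k; have := enum_uniq 'I_n.
move: (enum 'I_n) => e ue /esym; rewrite inE => /esym ke; case/splitPr: ke ue => s1 s2.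
rewrite cat_uniq /= negb_or => /and3P[_ /andP[k1 _] /andP[k2 _]].
rewrite map_cat /=; apply: mixed_mom_singleton => //.
  apply: contra k1; rewrite /unzip1 -map_comp => /mapP[j js /esym/fk E].
  by rewrite -E.
apply: contra k2; rewrite /unzip1 -map_comp => /mapP[j js /esym/fk E].
by rewrite -E.
Qed.

Lemma mixed_mom_pair_fibers (f : 'I_n -> nat) : (forall k, #|fiber f k| = 2%N) ->
  mixed_mom fc T [seq (f j, w j) | j <- enum 'I_n] = pair_sum w fc mu f.
Proof.
move=> f2.
have ex k : exists j, (j != k) && (f j == f k).
  have := cardsD1 k (fiber f k); rewrite fiber_mem f2 => -[] /esym /eqP /cards1P[j jE].
  by exists j; have : j \in fiber f k :\ k by [rewrite jE inE]; rewrite !inE.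
pose mate : 'I_n -> 'I_n := fun k => xchoose (ex k).
have /all_and2 [mn fm] : forall k, mate k != k /\ f (mate k) = f k.
  by move=> k; have /andP[? /eqP ?] := xchooseP (ex k).
have ff j k : f j = f k -> j = k \/ j = mate k.
  move=> fjk; have [->|jk] := eqVneq j k; first by left.
  right; apply/eqP; apply: contraLR (leqnn 2) => jm;
  rewrite -ltnNge -[X in (2 < X)%N](f2 k) (cardsD1 k) fiber_mem (cardsD1 (mate k)).
  rewrite !inE mn fm eqxx /= (cardsD1 j) !inE jk jm fjk eqxx //.
have mK : involutive mate.
  by move=> k; case: (ff k (mate k)) => [|E|//]; [rewrite fm|move: (mn k); rewrite -E eqxx].
rewrite (mixed_mom_pairs fc centered w mK mn fm ff) (pair_sum_pairing w fc mu mK mn fm ff) -/mu.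
rewrite (pairing_ibnc_ok _ mK mn); case: ifPn => [/forallP okA|/forallPn[k kN]].
  by rewrite [RHS]big_mkcond; apply: eq_bigr => k _; rewrite /step_weight okA.
by apply/eqP/prodf_eq0; exists k => //; rewrite /step_weight (negbTE kN).
Qed.

Lemma mixed_mom_neq_pair_sum N (f : {ffun 'I_n -> 'I_N}) :
  mixed_mom fc T [seq (val (f j), w j) | j <- enum 'I_n] != pair_sum w fc mu (fun k => f k) ->
  (#|f @: setT|.*2 < n)%N.
Proof.
have fE k : fiber (fun j => val (f j)) k = fiber f k by [].
move=> ne; apply: card_image_lt => [k|]; last first.
  apply: contra ne => /forallP H; apply/eqP; apply: mixed_mom_pair_fibers => k.
  by apply/eqP; exact: H.
rewrite ltnNge; apply: contra ne => k1.
have fk j : val (f j) = f k -> j = k.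
  move=> /eqP fjk; have /eqP/cards1P[a aE] : #|fiber f k| = 1%N.
    by apply/eqP; rewrite eqn_leq k1 fiber_gt0.
  have : j \in fiber f k by rewrite inE.
  by have := fiber_mem f k; rewrite aE !inE => /eqP -> /eqP.
by rewrite (mixed_mom_singleton_fiber fk) (pair_sum_singleton _ _ _ fk).
Qed.

End MixedMomentsVersusPairs.

(** * Moments of the normalized sums *)

Section IndependenceModel.
Variables (F : fieldType) (A : algType F) (phi : {scalar A}) (phi1 : phi 1 = 1).
Variables (I J K : choiceType).
Local Notation L := (I + J + K)%type.
Variable z : nat -> L -> A.

(** The generators belong to the algebras that they generate, so independence applies to
    words in the generators, with T i l the image of z i l. *)
Lemma independent_model : ffb_independent_seq phi z ->
  exists (X : nat -> pvect F) (T : forall i, L -> {linear X i -> X i}),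
  forall s : seq (nat * L),
    phi (\prod_(a <- s) z a.1 a.2) = mixed_mom (@face_of I J K) T s.
Proof.
move=> [X [h [_ H]]]; exists X, (fun i l => h i (face_of l) (z i l)) => s.
case: s => [|a0 s].
  by rewrite big_nil phi1 /mixed_mom /= vac_coef_tens.
set r := a0 :: s; pose a (k : 'I_(size s).+1) := nth a0 r k.
have -> : \prod_(a <- r) z a.1 a.2 = \prod_(k < (size s).+1) z (a k).1 (a k).2.
  by rewrite (big_nth a0) big_mkord.
rewrite (H _ (fun k => (a k).1) (fun k => face_of (a k).2)); last first.
  by move=> k M [_ SM]; apply: SM; exists (a k).2.
rewrite /vphi pv_fun_rfp /mixed_mom; congr vac_coef.
pose O (b : nat * L) : rfp X -> rfp X := face_op h b.1 (face_of b.2) (z b.1 b.2).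
have -> : \big[comp/id]_(k < (size s).+1) O (a k) = \big[comp/id]_(b <- r) O b.
  by rewrite (big_nth a0) big_mkord.
elim: {a}r => [|b r IH]; first by rewrite big_nil.
rewrite big_cons /= IH /O /op /face_op /face_action.
by case: (face_of b.2).
Qed.

End IndependenceModel.

Section ErrorEstimate.
Import boot.fintype boot.finset.
Local Open Scope set_scope.
Local Open Scope ring_scope.
Variables (F : numClosedFieldType) (X : nat -> pvect F) (I J K : choiceType).
Local Notation L := (I + J + K)%type.
Variable T : forall i, L -> {linear X i -> X i}.
Hypothesis centered : forall i l, mom T i [:: l] = 0.
Variables (n : nat) (w : 'I_n.+1 -> L).

Local Notation fc := (@face_of I J K).
Let mu i a b := mom T i [:: a; b].
Let em N (f : {ffun 'I_n.+1 -> 'I_N}) :=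
  mixed_mom fc T [seq (val (f j), w j) | j <- enum 'I_n.+1].
Let ps N (f : {ffun 'I_n.+1 -> 'I_N}) := pair_sum w fc mu (fun k => f k).

Definition average_cov N a b : F := N%:R^-1 * \sum_(m < N) mom T m [:: a; b].

Lemma pair_cumulant_size (C : L -> L -> F) (U : {set 'I_n.+1}) : #|U| != 2%N ->
  pair_cumulant C [seq w l | l <- enum U] = 0.
Proof.
by rewrite cardE -(size_map w); case: [seq _ | _ <- _] => [|? [|? []]].
Qed.

Lemma pair_cumulant_average N (U : {set 'I_n.+1}) :
  pair_cumulant (average_cov N) [seq w l | l <- enum U] =
  N%:R^-1 * \sum_(m < N) pair_cumulant (mu m) [seq w l | l <- enum U].
Proof.
case: [seq _ | _ <- _] => [|a [|b []]] //=; rewrite ?big1 ?mulr0//.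
Qed.

(** A pair partition of n + 1 points has (n + 1) / 2 blocks, so the factor
    sqrt N ^ -(n + 1) supplies exactly one 1 / N to the sum over the index of each block. *)
Lemma sum_pair_sum N :
  (sqrtC N.+1%:R)^-1 ^+ n.+1 * \sum_(f : {ffun 'I_n.+1 -> 'I_N.+1}) ps f =
  cmoment (pair_cumulant (average_cov N.+1)) w.
Proof.
rewrite exchange_big mulr_sumr; apply: eq_bigr => p; rewrite is_ibnc_on => /and3P[pp _ _].
have [/forall_inP p2|/forall_inPn[U Up U2]] := boolP [forall U in p, #|U| == 2%N]; last first.
  rewrite /block_weight (bigD1 U)//= pair_cumulant_size// mul0r big1 ?mulr0// => f _.
  rewrite (bigD1 U)//= /block_cov; move: U2; rewrite cardE.
  by case: (enum U) => [|? [|? []]]; rewrite ?mul0r.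
have p2' U : U \in p -> #|U| = 2%N by move=> /p2/eqP.
rewrite sum_prod_block_cov// /block_weight.
under [RHS]eq_bigr do rewrite pair_cumulant_average.
rewrite big_split /= prodr_const; congr (_ * _).
have nE : n.+1 = (2 * #|p|)%N.
  have := card_partition pp; rewrite cardsT card_ord (eq_bigr (fun=> 2%N))//.
  by rewrite sum_nat_const mulnC.
by rewrite [X in _ ^+ X = _]nE exprM exprVn sqrtCK.
Qed.

Variable M : F.
Hypothesis M0 : 0 <= M.
Hypothesis momM : forall i r, (size r <= n.+1)%N -> all [in codom w] r -> `|mom T i r| <= M.

Definition pair_sum_bound : F :=
  \sum_(p : {set {set 'I_n.+1}} | is_ibnc (fun k => fc (w k)) p) (M + 1) ^+ #|p|.

Let M1 : 0 <= M + 1. Proof. by rewrite addr_ge0. Qed.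

Lemma pair_sum_le N (f : {ffun 'I_n.+1 -> 'I_N}) : `|ps f| <= pair_sum_bound.
Proof.
apply: le_trans (ler_norm_sum _ _ _) _; apply: ler_sum => p _.
rewrite normr_prod -prodr_const; apply: ler_prod => U _; rewrite normr_ge0 /=.
have [->|] := eqVneq (block_cov w mu (fun k => f k) U) 0; first by rewrite normr0.
move=> /block_cov_neq0[a [b [ab UE _ ->]]].
apply: (@le_trans _ _ M); last by rewrite lerDl.
apply: momM => /=; last by rewrite !codom_f.
exact: (leq_ltn_trans (leq_ltn_trans (leq0n a) ab) (ltn_ord b)).
Qed.

Definition error_bound : F := ((M + 1) ^+ 2) ^+ n.+1 + pair_sum_bound.

Lemma mixed_mom_le N (f : {ffun 'I_n.+1 -> 'I_N}) : `|em f| <= ((M + 1) ^+ 2) ^+ n.+1.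
Proof.
have := @mixed_mom_bound F X L fc T [in codom w] n.+1 M M0 momM
   [seq (val (f j), w j) | j <- enum 'I_n.+1].
rewrite size_map size_enum_ord; apply=> //.
by rewrite /unzip2 -map_comp all_map; apply/allP => k _ /=; exact: codom_f.
Qed.

(** At most q ^ (n + 1) N ^ q maps contribute, with q = n / 2 rounded down; as 2 q <= n,
    at least one factor 1 / sqrt N is left over. *)
Lemma error_le N :
  `| (sqrtC N.+1%:R)^-1 ^+ n.+1 * \sum_(f : {ffun 'I_n.+1 -> 'I_N.+1}) em f
     - cmoment (pair_cumulant (average_cov N.+1)) w |
  <= error_bound * (n./2 ^ n.+1)%:R * (sqrtC N.+1%:R)^-1.
Proof.
rewrite -sum_pair_sum -mulrBr -sumrB normrM.
set q := n./2; set c := (sqrtC _)^-1.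
have c0 : 0 <= c by rewrite invr_ge0 sqrtC_ge0.
have c1 : c <= 1.
  by rewrite invf_le1 ?sqrtC_gt0 ?ltr0Sn// -[X in X <= _]sqrtC1 ler_sqrtC ?nnegrE// ler1n.
have B0 : 0 <= error_bound.
  by apply: addr_ge0; [rewrite !exprn_ge0|apply: sumr_ge0 => p _; rewrite exprn_ge0].
have S : `|\sum_(f : {ffun 'I_n.+1 -> 'I_N.+1}) (em f - ps f)| <=
    error_bound * (q ^ n.+1 * N.+1 ^ q)%:R.
  apply: le_trans (ler_norm_sum _ _ _) _.
  apply: (@le_trans _ _ (\sum_(f in
      [set f : {ffun 'I_n.+1 -> 'I_N.+1} | (#|f @: setT| <= q)%N]) error_bound)).
    rewrite [leRHS]big_mkcond; apply: ler_sum => f _; rewrite inE.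
    have [eqf|nef] := eqVneq (em f) (ps f).
      by rewrite eqf subrr normr0; case: ifP.
    have := mixed_mom_neq_pair_sum centered nef; rewrite ltnS => /half_leq.
    rewrite doubleK => ->; apply: le_trans (ler_normB _ _) _.
    by apply: lerD; [exact: mixed_mom_le|exact: pair_sum_le].
  rewrite sumr_const -[leLHS]mulr_natr ler_wpM2l// ler_nat; exact: card_small_image.
rewrite ger0_norm ?exprn_ge0//.
apply: le_trans (ler_wpM2l (exprn_ge0 _ c0) S) _.
rewrite natrM mulrCA -[leRHS]mulrA ler_wpM2l// mulrCA ler_wpM2l ?ler0n//.
have nE : n.+1 = ((odd n).+1 + 2 * q)%N by rewrite addSn mul2n odd_double_half.
have cN : c ^+ 2 * N.+1%:R = 1 by rewrite exprVn sqrtCK mulVf// pnatr_eq0.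
rewrite [X in c ^+ X]nE exprD exprM natrX -mulrA -exprMn cN expr1n mulr1 exprS.
by rewrite -[leRHS]mulr1 ler_wpM2l// exprn_ile1.
Qed.

End ErrorEstimate.

(** * Limits of complex sequences *)

Section ComplexLimits.
Variable R : realType.
Local Notation C := R[i].

Lemma norm_cabs (x : C) : `|x| = (cabs x)%:C.
Proof. by rewrite /cabs RRe_real// normr_real. Qed.

Lemma bounded_of_ereal_sup (u : nat -> C) :
  (ereal_sup (range (fun n => (cabs (u n))%:E)) < +oo)%E ->
  exists2 B : C, 0 <= B & forall n, `|u n| <= B.
Proof.
move=> ub.
have le n : ((cabs (u n))%:E <= ereal_sup (range (fun n => (cabs (u n))%:E)))%E.
  by apply: ereal_sup_ubound; exists n.
case: (ereal_sup _) ub le => [b _ le|//|_ /(_ 0%N)]; last by rewrite leeNy_eq.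
have H n : `|u n| <= b%:C by rewrite norm_cabs lecR -lee_fin.
by exists b%:C => //; exact: le_trans (normr_ge0 _) (H 0%N).
Qed.

(** The bound is required from index 1 on, since 1 / sqrt 0 is 0 by convention. *)
Lemma cvg_C_squeeze0 (u : nat -> C) (B : C) : 0 <= B ->
  (forall N, `|u N.+1| <= B * (sqrtC N.+1%:R)^-1) -> cvg_C u 0.
Proof.
move=> B0 uB; apply/cvg_CP => e e0.
have eE : (complex.Re e)%:C = e by rewrite RRe_real// gtr0_real.
have BE : (complex.Re B)%:C = B by rewrite RRe_real// ger0_real.
set b := complex.Re B in BE; set r := complex.Re e in eE.
have r0 : 0 < r by rewrite -ltcR eE.
have b0 : 0 <= b by rewrite -lecR BE.
(* B / sqrt N < e as soon as N exceeds (B / e) ^ 2. *)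
pose x := (b / r) ^+ 2.
have xP : x < (Num.bound x)%:R by exact: archi_boundP (sqr_ge0 _).
exists (Num.bound x).+1 => -[//|n]; rewrite ltnS => xn.
rewrite sub0r normrN; apply: le_lt_trans (uB n) _.
rewrite ltr_pdivrMr ?sqrtC_gt0 ?ltr0Sn// -ltr_pdivrMl//.
have : (x%:C : C) < n.+1%:R.
  rewrite -(rmorph_nat (real_complex R)) ltcR; apply: lt_le_trans xP _.
  by rewrite ler_nat (leq_trans xn).
rewrite -BE -eE mulrC /x rmorphXn /= rmorphM /= fmorphV => H.
rewrite -[ltLHS]sqrCK ?divr_ge0 ?lecR ?(ltW r0)//.
by rewrite ltr_sqrtC ?nnegrE ?exprn_ge0 ?divr_ge0 ?lecR ?(ltW r0)// ler0n.
Qed.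

Lemma cvg_C_ext (u v : nat -> C) l : cvg_C u l -> u =1 v -> cvg_C v l.
Proof. by move=> ul /funext <-. Qed.

Lemma cvg_C_cst (l : C) : cvg_C (fun=> l) l.
Proof. exact: cvg_cst. Qed.

Lemma cvg_CD (u v : nat -> C) l k : cvg_C u l -> cvg_C v k ->
  cvg_C (fun N => u N + v N) (l + k).
Proof. exact: cvgD. Qed.

Lemma cvg_CM (u v : nat -> C) l k : cvg_C u l -> cvg_C v k ->
  cvg_C (fun N => u N * v N) (l * k).
Proof. exact: cvgM. Qed.

Lemma cvg_C_sum (T : Type) (r : seq T) (P : pred T) (u : T -> nat -> C) (l : T -> C) :
  (forall t, cvg_C (u t) (l t)) ->
  cvg_C (fun N => \sum_(t <- r | P t) u t N) (\sum_(t <- r | P t) l t).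
Proof.
move=> H; elim: r => [|t r IH].
  by rewrite big_nil; apply: cvg_C_ext; [exact: cvg_C_cst|move=> N; rewrite big_nil].
rewrite big_cons; case: (boolP (P t)) => Pt.
  apply: cvg_C_ext; first exact: cvg_CD (H t) IH.
  by move=> N; rewrite big_cons Pt.
apply: cvg_C_ext; first exact: IH.
by move=> N; rewrite big_cons (negbTE Pt).
Qed.

Lemma cvg_C_prod (T : Type) (r : seq T) (P : pred T) (u : T -> nat -> C) (l : T -> C) :
  (forall t, cvg_C (u t) (l t)) ->
  cvg_C (fun N => \prod_(t <- r | P t) u t N) (\prod_(t <- r | P t) l t).
Proof.
move=> H; elim: r => [|t r IH].
  by rewrite big_nil; apply: cvg_C_ext; [exact: cvg_C_cst|move=> N; rewrite big_nil].
rewrite big_cons; case: (boolP (P t)) => Pt.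
  apply: cvg_C_ext; first exact: cvg_CM (H t) IH.
  by move=> N; rewrite big_cons Pt.
apply: cvg_C_ext; first exact: IH.
by move=> N; rewrite big_cons (negbTE Pt).
Qed.

End ComplexLimits.

(** * The central limit theorem *)

Section UniformMoments.
Variables (R : numDomainType) (L : choiceType) (m : nat -> seq L -> R).
Hypothesis m_bounded : forall r, exists2 B, 0 <= B & forall i, `|m i r| <= B.

(** There are finitely many words of length at most n in the letters of w, and the sum of
    their individual bounds bounds them all. *)
Lemma bounded_on_words n (w : 'I_n -> L) :
  exists2 M, 0 <= M & forall i r, (size r <= n)%N -> all [in codom w] r -> `|m i r| <= M.
Proof.
have /choice[Bd HB] : forall r, exists B, 0 <= B /\ forall i, `|m i r| <= B.
  by move=> r; have [B] := m_bounded r; exists B.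
pose M := \sum_(k < n.+1) \sum_(t : k.-tuple 'I_n) Bd [seq w j | j <- t].
have B0 r : 0 <= Bd r by have [] := HB r.
exists M => [|i r rn rw]; first by apply: sumr_ge0 => k _; apply: sumr_ge0.
have [t tr] : exists t : seq 'I_n, r = [seq w j | j <- t].
  elim: r rw {rn} => [|l r IH] /=; first by exists [::].
  by move=> /andP[/codomP[j ->] /IH[t ->]]; exists (j :: t).
have st : size t = size r by rewrite tr size_map.
apply: le_trans (proj2 (HB r) i) _.
pose k : 'I_n.+1 := Ordinal (rn : (size r < n.+1)%N).
rewrite /M (bigD1 k)//= (bigD1 (tcast st (in_tuple t)))//= val_tcast/= -tr.
rewrite -addrA lerDl addr_ge0 ?sumr_ge0// => k' _; exact: sumr_ge0.
Qed.

End UniformMoments.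

Theorem theorem6p4 (R : realType) (A : algType R[i]) (phi : {scalar A})
    (phi1 : phi 1 = 1) (I J K : choiceType)
    (z : nat -> (I + J + K)%type -> A)
    (C : (I + J + K)%type -> (I + J + K)%type -> R[i])
    (z_indep : ffb_independent_seq phi z)
    (z_centered : forall n l, phi (z n l) = 0)
    (z_bounded : forall s : seq (I + J + K)%type,
       (ereal_sup (range (fun n : nat =>
          (cabs (phi (\prod_(l <- s) z n l)))%:E)) < +oo)%E)
    (z_cov : forall l l',
       cvg_C (fun N : nat => N%:R^-1 * \sum_(n < N) phi (z n l * z n l'))
             (C l l')) :
  forall P : ncpoly R[i] (I + J + K)%type,
    cvg_C (fun N : nat => distr (normalized_sum z N) phi P) (Gamma C P).
Proof.
have [X [T modelE]] := independent_model phi1 z_indep.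
have momE i r : mom T i r = phi (\prod_(l <- r) z i l).
  by rewrite -(mixed_mom_const (@face_of I J K)) -modelE big_map.
have centered i l : mom T i [:: l] = 0 by rewrite momE big_seq1.
have bounded r : exists2 B, 0 <= B & forall i, `|mom T i r| <= B.
  have [B B0 H] := bounded_of_ereal_sup (z_bounded r).
  by exists B => // i; rewrite momE.
have cov k l : cvg_C (fun N => average_cov T N k l) (C k l).
  apply: cvg_C_ext; [exact: z_cov|move=> N]; congr (_ * _); apply: eq_bigr => m _.
  by rewrite momE !big_cons big_nil mulr1.
have word_cvg n (w : 'I_n -> I + J + K) :
    cvg_C (fun N => phi (\prod_(k < n) normalized_sum z N (w k))) (cmoment (pair_cumulant C) w).
  case: n w => [|n] w.
    have -> : cmoment (pair_cumulant C) w = 1.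
      rewrite -(cmoment_word_nil C) -cmoment_wordE; congr cmoment_word.
      by apply/eqP; rewrite -size_eq0 size_map size_enum_ord.
    by apply: cvg_C_ext; [exact: cvg_C_cst|move=> N; rewrite big_ord0 phi1].
  have [M M0 MP] := bounded_on_words bounded w.
  pose main N := cmoment (pair_cumulant (average_cov T N)) w.
  have main_cvg : cvg_C main (cmoment (pair_cumulant C) w).
    apply: cvg_C_sum => p; apply: cvg_C_prod => U.
    case: [seq _ | _ <- _] => [|a [|b []]] /=; by [exact: cvg_C_cst|exact: cov|move=> *; exact: cvg_C_cst].
  pose u N := phi (\prod_(k < n.+1) normalized_sum z N (w k)).
  have uE N : u N = (sqrtC N%:R)^-1 ^+ n.+1 *
      \sum_(f : {ffun 'I_n.+1 -> 'I_N})
        mixed_mom (@face_of I J K) T [seq (val (f j), w j) | j <- enum 'I_n.+1].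
    rewrite /u /normalized_sum scaler_prod prodr_const card_ord linearZ /=; congr (_ * _).
    rewrite bigA_distr_bigA linear_sum; apply: eq_bigr => f _.
    by rewrite -modelE big_map enumT -[Finite.enum _]/(index_enum _).
  have err : cvg_C (fun N => u N - main N) 0.
    apply: (@cvg_C_squeeze0 _ _ (error_bound w M * (n./2 ^ n.+1)%:R)).
      rewrite mulr_ge0 ?ler0n// addr_ge0 ?exprn_ge0 ?addr_ge0//.
      by apply: sumr_ge0 => p _; rewrite exprn_ge0 ?addr_ge0.
    by move=> N; rewrite uE; exact: error_le.
  rewrite -[cmoment _ _]add0r; apply: cvg_C_ext; first exact: cvg_CD err main_cvg.
  by move=> N; rewrite subrK.
have monom_cvg s :
    cvg_C (fun N => distr (normalized_sum z N) phi << FMonom s >>) (Gamma C << FMonom s >>).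
  rewrite Gamma_monom; apply: cvg_C_ext; first exact: word_cvg.
  move=> N.
  rewrite /distr /= -prod_ncvar; congr (phi _).
  rewrite rmorph_prod [RHS]big_tnth; apply: eq_bigr => k _; exact: esym (nceval_var _ _).
move=> P; rewrite (monalgE P) linear_sum.
apply: (@cvg_C_ext _ (fun N => \sum_(m <- msupp P)
  P@_m * distr (normalized_sum z N) phi << m >>)); last first.
  move=> N; pose ev : {linear ncpoly R[i] (I + J + K)%type -> A} := nceval (normalized_sum z N).
  rewrite -[RHS]/(phi (ev (\sum_(m <- msupp P) << P@_m *g m >>))) (linear_sum ev) (linear_sum phi).
  by apply: eq_bigr => m _; rewrite [in RHS]malgZU [ev _]linearZ [RHS]linearZ.
apply: cvg_C_sum => m; rewrite [in X in cvg_C _ X]malgZU linearZ /=.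
by apply: cvg_CM; [exact: cvg_C_cst|rewrite -[m]fmK; exact: monom_cvg].
Qed.
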